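(* Let $n\ge2$ be an integer and let $S'$ be the solvmanifold, with metric Lie algebra $\mathfrak s'=\mathfrak a\oplus\mathfrak n'$ as defined in the context, associated to the solvmanifold corresponding to the noncompact symmetric space $\mathsf{SL}(n,\mathbf H)/\mathsf{Sp}(n)$. Let $Z$ be any characteristic element, with corresponding set of simple roots $\Lambda'=\{\alpha\in\Lambda\mid\alpha(Z)=0\}$, and let $(S'_{\Lambda'},g')$ be the solvmanifold attached to $S'$, i.e. the simply connected solvable Lie group with Lie algebra $\mathfrak s'_{\Lambda'}=\mathfrak a_{\Lambda'}\oplus\mathfrak n'_{\Lambda'}$, equipped with the left-invariant metric $g'$ determined by the inner product restricted from $\mathfrak s'$. Then $(S'_{\Lambda'},g')$ is an Einstein solvmanifold.
   Context: A (Riemannian) solvmanifold is a solvable Lie group with a left-invariant Riemannian metric; a metric Lie algebra is a Lie algebra with an inner product, and it determines a simply connected Lie group with left-invariant metric. Einstein means that the Ricci tensor is a constant multiple of the metric. The Lie algebra. $$\mathfrak g=\mathfrak{sl}(n,\mathbf H)=\left\{\begin{pmatrix}X&-\overline Y\\ Y&\overline X\end{pmatrix}\ \Big|\ X,Y\in\mathfrak{gl}(n,\mathbf C),\ \operatorname{tr}(X+\overline X)=0\right\},$$ a real Lie algebra with Cartan involution $\sigma(A)=-\overline A^t$, Killing form $B$, and $B_\sigma(X,Y)=-B(X,\sigma(Y))$. Let $\mathfrak a=\{\operatorname{diag}(a_1,\dots,a_n,a_1,\dots,a_n)\mid a_i\in\mathbf R,\ \sum_{i=1}^na_i=0\}$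 and let $\omega_j\in\mathfrak a^*$ take such a matrix to $a_j$. Positive (restricted) roots: $\Delta^+=\{\omega_j-\omega_k\mid 1\le j<k\le n\}$; simple roots: $\Lambda=\{\alpha_1,\dots,\alpha_{n-1}\}$ with $\alpha_i=\omega_i-\omega_{i+1}$. Let $F_{rs}$ denote the $2n\times2n$ matrix unit with $1$ in entry $(r,s)$ and zeros elsewhere. For $1\le j<k\le n$ the root space is the real span $\mathfrak n_{\omega_j-\omega_k}=\operatorname{span}\{A_{jk},B_{jk},C_{jk},D_{jk}\}$ with $$A_{jk}=i\sqrt2\,(F_{jk}-F_{n+j,n+k}),\quad B_{jk}=i\sqrt2\,(F_{j,n+k}+F_{n+j,k}),$$ $$C_{jk}=\sqrt2\,(F_{j,n+k}-F_{n+j,k}),\quad D_{jk}=\sqrt2\,(F_{jk}+F_{n+j,n+k}).$$ Put $\mathfrak n=\sum_{j<k}\mathfrak n_{\omega_j-\omega_k}$ and $\mathfrak s=\mathfrak a\oplus\mathfrak n$, with inner product $\langle\,,\rangle=2B_\sigma|_{\mathfrak a\times\mathfrak a}+B_\sigma|_{\mathfrak n\times\mathfrak n}$ ($\mathfrak a\perp\mathfrak n$); the corresponding simply connected solvmanifold is the symmetric space $\mathsf{SL}(n,\mathbf H)/\mathsf{Sp}(n)$. The associated metric Lie algebra $\mathfrak s'$. Let $\mathfrak g^{\mathbf C}=\mathfrak g\otimes_{\mathbf R}\mathbf C$, viewed as a real Lie algebra, and let $\sqrt{-1}$ be the imaginary unit of the second tensor factor (distinct from the matrix scalar $i$). Let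 $\mathfrak n'\subset\mathfrak g^{\mathbf C}$ be the real span of $\sqrt{-1}A_{jk},\ B_{jk},\ \sqrt{-1}C_{jk},\ D_{jk}$ for $1\le j<k\le n$, and $\mathfrak s'=\mathfrak a\oplus\mathfrak n'$, a real solvable Lie subalgebra of $\mathfrak g^{\mathbf C}$. Its inner product is the one for which the linear bijection $\mathfrak s\to\mathfrak s'$ that is the identity on $\mathfrak a$ and sends $A_{jk}\mapsto\sqrt{-1}A_{jk}$, $B_{jk}\mapsto B_{jk}$, $C_{jk}\mapsto\sqrt{-1}C_{jk}$, $D_{jk}\mapsto D_{jk}$ is an isometry. $S'$ is the simply connected solvmanifold with metric Lie algebra $\mathfrak s'$. Attached subalgebras. Let $\{H^1,\dots,H^{n-1}\}$ be the basis of $\mathfrak a$ with $\alpha_i(H^j)=\delta_{ij}$. A characteristic element is $Z=c_{i_1}H^{i_1}+\dots+c_{i_k}H^{i_k}$ with $k\ge1$, distinct indices $i_1,\dots,i_k$, and positive integers $c_{i_1},\dots,c_{i_k}$; then $\Lambda'=\{\alpha\in\Lambda\mid\alpha(Z)=0\}=\Lambda\setminus\{\alpha_{i_1},\dots,\alpha_{i_k}\}$. Put $\mathfrak a_{\Lambda'}=\operatorname{span}\{H^{i_1},\dots,H^{i_k}\}$ and $\mathfrak n'_{\Lambda'}=\sum_{\alpha\in\Delta^+,\ \alpha(Z)>0}\mathfrak n'_\alpha$, where $\mathfrak n'_\alpha=\{X\in\mathfrak n'\mid[A,X]=\alpha(A)X\ \ \forall A\in\mathfrak a\}$. *)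

(* Defs.v *)
From HB Require Import structures.
From mathcomp Require Import all_boot all_order all_algebra.
From mathcomp Require Import boolp classical_sets reals.
From mathcomp Require Import complex.
Set Implicit Arguments.
Unset Strict Implicit.
Unset Printing Implicit Defensive.
Import Order.TTheory GRing.Theory Num.Theory.
Local Open Scope ring_scope.

Section LinearAlgebra.
Context (R : realType) (V : vectType R).

(** The linear span of an arbitrary set of vectors. When the set is itself a
    linear subspace, the span has exactly its elements ([mem_set_span]). *)
Definition is_set_span (P : set V) (U : {vspace V}) : Prop :=
  (forall x, P x -> x \in U) /\
  (forall W : {vspace V}, (forall x, P x -> x \in W) -> (U <= W)%VS).

Definition set_span (P : set V) : {vspace V} := xget 0%VS (is_set_span P).

Lemma set_spanP (P : set V) : is_set_span P (set_span P).
Proof.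
apply: xgetPex.
pose Q d := `[< exists2 W : {vspace V}, forall x, P x -> x \in W & \dim W = d >].
have exQ : exists d, Q d.
  by exists (\dim (fullv : {vspace V})); apply/asboolP; exists fullv => // x _; apply: memvf.
case: (ex_minnP exQ) => d /asboolP[U PU dU] dmin; exists U; split=> // W PW.
have: (d <= \dim (U :&: W)%VS)%N.
  apply: dmin; apply/asboolP; exists (U :&: W)%VS => // x Px.
  by rewrite memv_cap PU ?PW.
by rewrite -dU (geq_leqif (dimv_leqif_sup (capvSl U W))) subv_cap => /andP[].
Qed.

Lemma mem_set_span (P : set V) :
  P 0 -> (forall a x y, P x -> P y -> P (a *: x + y)) ->
  forall x, x \in set_span P <-> P x.
Proof.
move=> P0 Plin x; have [sub min] := set_spanP P.
split=> [|Px]; last exact: sub.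
pose Q d := `[< exists2 W : {vspace V}, forall x, x \in W -> P x & \dim W = d >].
have exQ : exists d, Q d.
  exists 0%N; apply/asboolP; exists 0%VS; last by rewrite dimv0.
  by move=> y; rewrite memv0 => /eqP->.
have Qbound d : Q d -> (d <= \dim (fullv : {vspace V}))%N.
  by move=> /asboolP[W _ <-]; apply/dimvS/subvf.
case: (ex_maxnP exQ Qbound) => d /asboolP[U UP dU] dmax.
move=> xS; apply: (UP); apply: (subvP (min U _)) xS => y Py.
have: (\dim (U + <[y]>)%VS <= d)%N.
  apply: dmax; apply/asboolP; exists (U + <[y]>)%VS => //.
  move=> z /memv_addP[u uU [v /vlineP[a ->] ->]].
  by rewrite addrC; apply: Plin => //; apply: UP.
by rewrite -dU (geq_leqif (dimv_leqif_sup (addvSl U <[y]>))) subv_add -memvE => /andP[].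
Qed.

(** Trace of an endomorphism of [U], given by a function preserving [U]. *)
Definition trace_on (U : {vspace V}) (f : V -> V) : R :=
  \sum_(i < \dim U) coord (vbasis U) i (f (vbasis U)`_i).

End LinearAlgebra.

(** Lie algebras are subspaces [U] of an ambient space [V] that carries a
    bracket [br]; only the values of [br] and [ip] on [U] matter. *)
Section MetricLieAlgebra.
Context (R : realType) (V : vectType R).
Implicit Types (br nabla : V -> V -> V) (ip : V -> V -> R) (U W : {vspace V}).

Definition killing_form br U (x y : V) : R :=
  trace_on U (fun z => br x (br y z)).

Record lie_algebra br U : Prop := LieAlgebra {
  lie_closed : {in U &, forall x y, br x y \in U};
  lie_linear : forall a, {in U & &, forall x y z,
    br (a *: x + y) z = a *: br x z + br y z};
  lie_alternating : {in U, forall x, br x x = 0};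
  lie_jacobi : {in U & &, forall x y z,
    br x (br y z) + br y (br z x) + br z (br x y) = 0} }.

Record inner_product ip U : Prop := InnerProduct {
  ip_linear : forall a, {in U & &, forall x y z,
    ip (a *: x + y) z = a * ip x z + ip y z};
  ip_sym : {in U &, forall x y, ip x y = ip y x};
  ip_pos : {in U, forall x, x != 0 -> 0 < ip x x} }.

Definition brackets br U W : {vspace V} :=
  set_span [set z | exists x y, [/\ x \in U, y \in W & z = br x y]].

Definition derived_series br U (k : nat) : {vspace V} :=
  iter k (fun W => brackets br W W) U.

Definition solvable_lie br U : Prop := exists k, derived_series br U k = 0%VS.

(** The Levi-Civita connection of the left-invariant metric with metric Lie
    algebra [U], evaluated on left-invariant vector fields; it is unique on
    [U]. Inner products of left-invariant fields are constant, so metric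
    compatibility reads <nabla_x y, z> + <y, nabla_x z> = 0. *)
Record levi_civita br ip U nabla : Prop := LeviCivita {
  lc_closed : {in U &, forall x y, nabla x y \in U};
  lc_linearl : forall a, {in U & &, forall x y z,
    nabla (a *: x + y) z = a *: nabla x z + nabla y z};
  lc_linearr : forall a, {in U & &, forall x y z,
    nabla z (a *: x + y) = a *: nabla z x + nabla z y};
  lc_torsion_free : {in U &, forall x y, nabla x y - nabla y x = br x y};
  lc_metric : {in U & &, forall x y z,
    ip (nabla x y) z + ip y (nabla x z) = 0} }.

Definition curvature br nabla (x y z : V) : V :=
  nabla x (nabla y z) - nabla y (nabla x z) - nabla (br x y) z.

Definition ricci br U nabla (x y : V) : R :=
  trace_on U (fun z => curvature br nabla z x y).

Definition einstein br ip U : Prop :=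
  exists2 nabla, levi_civita br ip U nabla
    & exists c : R, {in U &, forall x y, ricci br U nabla x y = c * ip x y}.

(** The simply connected Lie group with Lie algebra [U], with the left-invariant
    metric determined by [ip], is an Einstein solvmanifold. *)
Record einstein_solvmanifold br ip U : Prop := EinsteinSolvmanifold {
  es_lie : lie_algebra br U;
  es_ip : inner_product ip U;
  es_solvable : solvable_lie br U;
  es_einstein : einstein br ip U }.

End MetricLieAlgebra.

(** Complex matrices of size 2n as a real vector space. *)
Definition cmx (R : realType) (n : nat) := 'M[R[i]]_(n + n).

HB.instance Definition _ R n := GRing.Zmodule.on (cmx R n).

Section RealStructure.
Context (R : realType) (n : nat).

Definition cmx_scale (a : R) (M : cmx R n) : cmx R n :=
  (a%:C%C *: (M : 'M[R[i]]_(n + n))).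

Fact cmx_scaleA a b M : cmx_scale a (cmx_scale b M) = cmx_scale (a * b) M.
Proof. by rewrite /cmx_scale scalerA -rmorphM. Qed.
Fact cmx_scale1 : left_id 1 cmx_scale.
Proof. by move=> M; rewrite /cmx_scale rmorph1 scale1r. Qed.
Fact cmx_scaleDr : right_distributive cmx_scale +%R.
Proof. by move=> a M N; rewrite /cmx_scale scalerDr. Qed.
Fact cmx_scaleDl M : {morph cmx_scale^~ M : a b / a + b}.
Proof. by move=> a b; rewrite /cmx_scale rmorphD scalerDl. Qed.

HB.instance Definition _ := GRing.Zmodule_isLmodule.Build R (cmx R n)
  cmx_scaleA cmx_scale1 cmx_scaleDr cmx_scaleDl.

Let cmx_v2r (M : cmx R n) : 'rV[R]_((n + n) * (n + n) + (n + n) * (n + n)) :=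
  row_mx (mxvec (map_mx (@complex.Re R) M)) (mxvec (map_mx (@complex.Im R) M)).

Fact cmx_vect_iso :
  Vector.axiom ((n + n) * (n + n) + (n + n) * (n + n)) (cmx R n).
Proof.
exists cmx_v2r.
  move=> a M N; rewrite /cmx_v2r scale_row_mx add_row_mx -!linearP.
  congr (row_mx (mxvec _) (mxvec _)); apply/matrixP=> i j; rewrite !mxE /=.
    by case: (M i j) (N i j) => [x y] [z t] /=; rewrite mul0r subr0.
  by case: (M i j) (N i j) => [x y] [z t] /=; rewrite mul0r addr0.
exists (fun v => \matrix_(i, j)
  Complex (vec_mx (lsubmx v) i j) (vec_mx (rsubmx v) i j)).
  move=> M; apply/matrixP=> i j.
  by rewrite /cmx_v2r mxE row_mxKl row_mxKr !mxvecK !mxE; case: (M i j).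
move=> v; rewrite /cmx_v2r -[RHS]hsubmxK.
by congr row_mx; apply: (canLR vec_mxK); apply/matrixP=> i j; rewrite !mxE.
Qed.

HB.instance Definition _ := Lmodule_hasFinDim.Build R (cmx R n) cmx_vect_iso.

End RealStructure.

Section SLnH.
Context (R : realType) (n : nat).
Local Notation cmx := (cmx R n).

Definition br (X Y : cmx) : cmx := X *m Y - Y *m X.

Definition slnH : {vspace cmx} :=
  set_span [set M : cmx | exists X Y : 'M[R[i]]_n,
    M = block_mx X (- map_mx conjc Y) Y (map_mx conjc X) /\
    \tr (X + map_mx conjc X) = 0].

Definition cartan_inv (X : cmx) : cmx := - (map_mx conjc X)^T.

Definition B_sigma (X Y : cmx) : R := - killing_form br slnH X (cartan_inv Y).

Definition diag2 (v : 'rV[R]_n) : cmx :=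
  diag_mx (row_mx (map_mx (real_complex R) v) (map_mx (real_complex R) v)).

Definition aspace : {vspace cmx} :=
  set_span [set M : cmx | exists v : 'rV[R]_n, M = diag2 v /\ \sum_i v 0 i = 0].

Definition omega (j : 'I_n) (X : cmx) : R := complex.Re (X (lshift n j) (lshift n j)).

Definition rroot (j k : 'I_n) (X : cmx) : R := omega j X - omega k X.

Definition sqrt2 : R[i] := (Num.sqrt (2 : R))%:C%C.

Local Notation F r s := (delta_mx r s : 'M[R[i]]_(n + n)).
Local Notation top := (lshift n).
Local Notation bot := (rshift n).

Definition genA (j k : 'I_n) : cmx :=
  ('i%C * sqrt2) *: (F (top j) (top k) - F (bot j) (bot k)).
Definition genB (j k : 'I_n) : cmx :=
  ('i%C * sqrt2) *: (F (top j) (bot k) + F (bot j) (top k)).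
Definition genC (j k : 'I_n) : cmx :=
  sqrt2 *: (F (top j) (bot k) - F (bot j) (top k)).
Definition genD (j k : 'I_n) : cmx :=
  sqrt2 *: (F (top j) (top k) + F (bot j) (bot k)).

Definition nspace : {vspace cmx} :=
  (\sum_(p : 'I_n * 'I_n | (p.1 < p.2)%N)
     <<[:: genA p.1 p.2; genB p.1 p.2; genC p.1 p.2; genD p.1 p.2]>>)%VS.

Definition sspace : {vspace cmx} := (aspace + nspace)%VS.

(** [daddv_pi U W] is the projection onto [U] along [W]. *)
Definition ip_s (x y : cmx) : R :=
  2 * B_sigma (daddv_pi aspace nspace x) (daddv_pi aspace nspace y)
  + B_sigma (daddv_pi nspace aspace x) (daddv_pi nspace aspace y).

(** The complexification: the pair [(X, Y)] stands for X + sqrt(-1) Y, where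
    sqrt(-1) is the new imaginary unit, distinct from the matrix scalar i.
    The subspace of pairs with both entries in [slnH] is g tensor C. *)
Definition gC : Type := (cmx * cmx)%type.
HB.instance Definition _ := Vector.on gC.

Definition brC (u v : gC) : gC :=
  (br u.1 v.1 - br u.2 v.2, br u.1 v.2 + br u.2 v.1).

Definition re_part (X : cmx) : gC := (X, 0).
Definition im_part (X : cmx) : gC := (0, X).

Definition aspaceC : {vspace gC} := (linfun re_part @: aspace)%VS.

Definition nspace' : {vspace gC} :=
  (\sum_(p : 'I_n * 'I_n | (p.1 < p.2)%N)
     <<[:: im_part (genA p.1 p.2); re_part (genB p.1 p.2);
           im_part (genC p.1 p.2); re_part (genD p.1 p.2)]>>)%VS.

Definition sspace' : {vspace gC} := (aspaceC + nspace')%VS.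

(** Restricted to s', this is the inverse of the linear bijection from s to s'
    that defines the metric of s' (see [untwistK]). *)
Definition untwist (u : gC) : cmx := u.1 + u.2.

Definition ip' (u v : gC) : R := ip_s (untwist u) (untwist v).

Record is_twist (phi : 'Hom(cmx, gC)) : Prop := IsTwist {
  twist_a : {in aspace, forall X, phi X = re_part X};
  twist_A : forall j k : 'I_n, (j < k)%N -> phi (genA j k) = im_part (genA j k);
  twist_B : forall j k : 'I_n, (j < k)%N -> phi (genB j k) = re_part (genB j k);
  twist_C : forall j k : 'I_n, (j < k)%N -> phi (genC j k) = im_part (genC j k);
  twist_D : forall j k : 'I_n, (j < k)%N -> phi (genD j k) = re_part (genD j k) }.

Definition nroot' (j k : 'I_n) : {vspace gC} :=
  set_span [set X : gC | X \in nspace' /\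
    {in aspace, forall A, brC (re_part A) X = rroot j k A *: X}].

(** Simple roots are indexed from 0: [simple_root i] is omega_i - omega_(i+1)
    for 0 <= i < n - 1. *)
Fact ord_succ_subproof (i : 'I_n.-1) : (i.+1 < n)%N.
Proof. by rewrite -ltn_predRL. Qed.

Definition simple_root (i : 'I_n.-1) : cmx -> R :=
  rroot (widen_ord (leq_pred n) i) (Ordinal (ord_succ_subproof i)).

(** The basis of [aspace] dual to the simple roots (see [simple_root_dual]). *)
Definition Hdual (j : 'I_n.-1) : cmx :=
  diag2 (\row_(k < n) ((k <= j)%N%:R - j.+1%:R / n%:R)).

(** Set of the simple roots that vanish on [Z]. *)
Definition Lambda' (Z : cmx) : {set 'I_n.-1} := [set i | simple_root i Z == 0].

Definition attached_a (Z : cmx) : {vspace cmx} :=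
  <<[seq Hdual i | i in ~: Lambda' Z]>>%VS.

Definition attached_n' (Z : cmx) : {vspace gC} :=
  (\sum_(p : 'I_n * 'I_n | (p.1 < p.2)%N && (0 < rroot p.1 p.2 Z)%R)
     nroot' p.1 p.2)%VS.

Definition attached_s' (Z : cmx) : {vspace gC} :=
  (linfun re_part @: attached_a Z + attached_n' Z)%VS.

Definition characteristic_element (Z : cmx) : Prop :=
  exists (I : {set 'I_n.-1}) (c : 'I_n.-1 -> nat),
    [/\ I != finset.set0, {in I, forall i, (0 < c i)%N}
      & Z = \sum_(i in I) (c i)%:R *: Hdual i].

Fact re_part_linear : linear re_part.
Proof.
by move=> a X Y; rewrite /re_part; congr pair; rewrite /= scaler0 addr0.
Qed.
HB.instance Definition _ :=
  GRing.isLinear.Build R cmx gC *:%R re_part re_part_linear.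

Fact untwist_linear : linear untwist.
Proof.
by move=> a u v; rewrite /untwist /= addrACA -scalerDr.
Qed.
HB.instance Definition _ :=
  GRing.isLinear.Build R gC cmx *:%R untwist untwist_linear.

Lemma omega_diag2 j (v : 'rV[R]_n) : omega j (diag2 v) = v 0 j.
Proof. by rewrite /omega /diag2 mxE eqxx mulr1n row_mxEl mxE. Qed.

Lemma diag2_mem (v : 'rV[R]_n) : \sum_i v 0 i = 0 -> diag2 v \in aspace.
Proof. by move=> v0; apply: (set_spanP _).1; exists v. Qed.

Lemma Hdual_mem j : Hdual j \in aspace.
Proof.
apply: diag2_mem; under eq_bigr do rewrite mxE.
have n0 : (n%:R : R) != 0.
  by rewrite pnatr_eq0 -lt0n; apply: leq_trans (ord_succ_subproof j).
rewrite sumrB sumr_const card_ord -[X in _ - X]mulr_natr divfK //.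
apply/eqP; rewrite subr_eq0 -natr_sum; apply/eqP; congr _%:R.
rewrite -(big_mkord xpredT (fun k => (k <= j)%N : nat)).
rewrite (big_cat_nat (n := j.+1)) //=; last first.
  by apply: ltnW; apply: ord_succ_subproof.
rewrite [X in (_ + X)%N]big_nat_cond [X in (_ + X)%N]big1 ?addn0; last first.
  by move=> i /andP[/andP[ji _] _]; rewrite leqNgt ji.
rewrite big_nat_cond (eq_bigr (fun=> 1%N)); last first.
  by move=> i /andP[/andP[_ ij] _]; rewrite -ltnS ij.
by rewrite -big_nat_cond sum_nat_const_nat subn0 muln1.
Qed.

Lemma simple_root_dual i j : simple_root i (Hdual j) = (i == j)%:R.
Proof.
rewrite /simple_root /rroot /Hdual !omega_diag2 !mxE /= opprB addrA subrK.
by rewrite -val_eqE /=; case: ltngtP => _; rewrite ?subrr ?subr0.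
Qed.

Lemma untwistK (phi : 'Hom(cmx, gC)) :
  is_twist phi -> {in sspace, cancel phi untwist}.
Proof.
case=> [ta tA tB tC tD]; rewrite /sspace /nspace.
pose psi : 'Hom(cmx, cmx) := (linfun untwist \o phi)%VF.
have E X : psi X = untwist (phi X) by rewrite comp_lfunE lfunE.
suff sub : (aspace + nspace <= fixedSpace psi)%VS.
  by move=> X /(subvP sub)/fixedSpaceP; rewrite E.
rewrite subv_add; apply/andP; split.
  by apply/subvP=> X Xa; apply/fixedSpaceP; rewrite E ta // /untwist addr0.
apply/subv_sumP=> -[j k] /= jk; apply/span_subvP=> X; rewrite !inE.
by case/or4P=> /eqP->; apply/fixedSpaceP;
  rewrite E ?tA ?tB ?tC ?tD // /untwist /= ?addr0 ?add0r.
Qed.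

Lemma ip'_twist (phi : 'Hom(cmx, gC)) : is_twist phi ->
  {in sspace &, forall x y, ip' (phi x) (phi y) = ip_s x y}.
Proof. by move=> h x y xs ys; rewrite /ip' !untwistK. Qed.

End SLnH.

(* Main.v *)
Require Import Defs.
From HB Require Import structures.
From mathcomp Require Import all_boot all_order all_algebra.
From mathcomp Require Import boolp classical_sets reals complex.
From mathcomp Require Import ring lra zify.

(** The quaternion algebra twisted by sqrt(-1) on the components A and C is the
    split quaternion algebra M_2(R), so the attached algebra is isomorphic to the
    algebra of real 2n x 2n matrices that are block upper triangular for the
    even-sized blocks cut out by [Z], have zero trace, and are scalar on each
    diagonal block. The Killing form of sl(n, H) turns its inner product into
    4n (2 sum_i x_ii y_ii + sum_(i <> j) x_ij y_ij).

    For a left-invariant metric, with D_x z = nabla_z x, one has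
    Ric(x, y) = - tr ad (nabla_x y) - tr (D_x D_y). Evaluating the traces on
    matrix units gives, at the entry (p, q) above the diagonal blocks, half of
    #{j between p and q} - #{j after p} - #{j before q} (comparing blocks),
    which is - N / 2 with N = 2n, since every j lies after p or before q. On the
    abelian part the Ricci form is minus the sum of the squared roots, that is
    - N sum_i x_ii y_ii. *)

Set Implicit Arguments.
Unset Strict Implicit.
Unset Printing Implicit Defensive.
Import Order.TTheory GRing.Theory Num.Theory.
Local Open Scope ring_scope.

(** * Ricci curvature of a metric Lie algebra with a tight frame *)

(** Two different maps link the attached algebra to real matrices. The bracket travels through
    [Phi], which is an algebra embedding. The metric is defined on s, so it travels through [Theta],
    which undoes the twist after [Phi] and does not respect brackets. The curvature is therefore
    computed once for abstract data ([memU], [brPhi], [ipPhi]), and the two maps supply these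
    hypotheses separately. The factor 2 on the abelian part of the metric is what balances the Ricci
    values: -N/2 against weight 1 above the blocks, -N against weight 2 on the diagonal. *)

Section LinearOn.
Context (R : realType) (V : vectType R) (U : {vspace V}).

Definition linear_on (W : lmodType R) (f : V -> W) : Prop :=
  forall a, {in U &, forall x y, f (a *: x + y) = a *: f x + f y}.

Lemma linear_on0 (W : lmodType R) (f : V -> W) : linear_on f -> f 0 = 0.
Proof.
move=> lf; have := lf (-1) 0 0 (mem0v U) (mem0v U).
by rewrite scaler0 addr0 scaleN1r addNr.
Qed.

Lemma linear_on_sum (W : lmodType R) (f : V -> W) (I : finType)
    (c : I -> R) (v : I -> V) :
  linear_on f -> (forall i, v i \in U) ->
  f (\sum_i c i *: v i) = \sum_i c i *: f (v i).
Proof.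
move=> lf vU.
suff [] : f (\sum_i c i *: v i) = \sum_i c i *: f (v i) /\
  \sum_i c i *: v i \in U by [].
elim/big_rec2: _ => [|i x y _ [<- yU]]; first by rewrite linear_on0 ?mem0v.
by rewrite lf // memvD // memvZ.
Qed.

(** A sum of rank-one maps has as trace the sum of the values of the functionals at their own
    vectors. The [u i] may be linearly dependent, which redundant frames require. *)
Lemma trace_on_frame (f : V -> V) (I : finType) (phi : I -> V -> R^o) (u : I -> V) :
  (forall i, linear_on (phi i)) -> (forall i, u i \in U) ->
  {in U, forall z, f z = \sum_i phi i z *: u i} ->
  trace_on U f = \sum_i phi i (u i).
Proof.
move=> lphi uU fE; rewrite /trace_on.
have bU (k : 'I_(\dim U)) : (vbasis U)`_k \in U.
  by apply: vbasis_mem; rewrite mem_nth // size_tuple.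
under eq_bigr => k _ do rewrite fE // linear_sum.
rewrite exchange_big; apply: eq_bigr => i _ /=.
rewrite [in RHS](coord_vbasis (uU i)) (linear_on_sum _ (lphi i)) //.
by apply: eq_bigr => k _; rewrite linearZ /= mulrC.
Qed.

End LinearOn.

(* [e] is a weighted tight frame rather than an orthonormal basis, so that
   redundant families such as projections of matrix units can be used. *)
Section MetricFrame.
Context (R : realType) (V : vectType R) (U : {vspace V}).
Variables (br : V -> V -> V) (ip : V -> V -> R).
Variables (I : finType) (e : I -> V) (w : I -> R).
Hypothesis lieU : lie_algebra br U.
Hypothesis ipU : inner_product ip U.
Hypothesis eU : forall i, e i \in U.
Hypothesis frame : {in U, forall x, x = \sum_i (w i * ip x (e i)) *: e i}.

Lemma ip_linear_on z : z \in U -> linear_on U (fun x => ip x z : R^o).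
Proof. by move=> zU a x y xU yU; apply: (ip_linear ipU). Qed.

Lemma ip_linear_onr z : z \in U -> linear_on U (fun x => ip z x : R^o).
Proof.
move=> zU a x y xU yU /=.
by rewrite !(ip_sym ipU zU) ?memvD ?memvZ // (ip_linear ipU).
Qed.

Lemma ip0l z : z \in U -> ip 0 z = 0.
Proof. by move=> /ip_linear_on/linear_on0. Qed.

Lemma ipDl : {in U & &, forall x y z, ip (x + y) z = ip x z + ip y z}.
Proof. by move=> x y z xU yU zU; rewrite -[x]scale1r (ip_linear ipU) // mul1r scale1r. Qed.

Lemma ipNl : {in U &, forall x z, ip (- x) z = - ip x z}.
Proof.
move=> x z xU zU; rewrite -[- x]addr0 -scaleN1r (ip_linear ipU) ?mem0v //.
by rewrite ip0l // addr0 mulN1r.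
Qed.

Lemma ip_suml (J : finType) (c : J -> R) (v : J -> V) z :
  z \in U -> (forall j, v j \in U) ->
  ip (\sum_j c j *: v j) z = \sum_j c j * ip (v j) z.
Proof. by move=> /ip_linear_on lz vU; rewrite (linear_on_sum _ lz). Qed.

Lemma mem_frame_sum (c : I -> R) : \sum_i c i *: e i \in U.
Proof. by apply: memv_suml => i _; apply: memvZ. Qed.

Lemma trace_on_ip (f : V -> V) :
  linear_on U f -> {in U, forall x, f x \in U} ->
  trace_on U f = \sum_i w i * ip (f (e i)) (e i).
Proof.
move=> lf fU.
rewrite (@trace_on_frame _ _ _ f _ (fun i z => w i * ip z (e i)) (f \o e)) //=.
- by move=> i a x y xU yU /=; rewrite (ip_linear ipU) // mulrDr mulrCA.
- by move=> i; apply: fU.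
by move=> z zU; rewrite {1}(frame zU) (linear_on_sum _ lf).
Qed.

Lemma trace_on_comp (f g : V -> V) :
  linear_on U f -> {in U, forall x, f x \in U} ->
  linear_on U g -> {in U, forall x, g x \in U} ->
  trace_on U (f \o g) =
  \sum_i \sum_j w i * w j * (ip (g (e i)) (e j) * ip (f (e j)) (e i)).
Proof.
move=> lf fU lg gU; rewrite trace_on_ip => [|a x y xU yU /=|x xU /=].
- apply: eq_bigr => i _ /=; rewrite {1}(frame (gU _ (eU i))) (linear_on_sum _ lf) //.
  rewrite ip_suml // => [|j]; last exact: fU.
  by rewrite mulr_sumr; apply: eq_bigr => j _; rewrite -!mulrA.
- by rewrite lg // lf // gU.
- by rewrite fU ?gU.
Qed.

Lemma trace_on_compC (f g : V -> V) :
  linear_on U f -> {in U, forall x, f x \in U} ->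
  linear_on U g -> {in U, forall x, g x \in U} ->
  trace_on U (f \o g) = trace_on U (g \o f).
Proof.
move=> lf fU lg gU; rewrite !trace_on_comp // exchange_big /=.
apply: eq_bigr => i _; apply: eq_bigr => j _.
by rewrite [w j * _]mulrC [X in _ * X]mulrC.
Qed.

Hypothesis br_skew : {in U &, forall x y, br y x = - br x y}.

Lemma br_linearr x : x \in U -> linear_on U (br x).
Proof.
move=> xU a y z yU zU; rewrite br_skew ?memvD ?memvZ //.
by rewrite (lie_linear lieU) // opprD -scalerN -!br_skew.
Qed.

(** The derivative terms of the general Koszul formula are absent: inner products of left-invariant
    fields are constant. *)
Definition koszul (x y z : V) : R :=
  (ip (br x y) z - ip (br y z) x + ip (br z x) y) / 2.

Definition koszul_connection (x y : V) : V :=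
  \sum_i (w i * koszul x y (e i)) *: e i.

Local Notation nabla := koszul_connection.

Let brU := lie_closed lieU.

Lemma koszulE : {in U & &, forall x y z, ip (nabla x y) z = koszul x y z}.
Proof.
move=> x y z xU yU zU; rewrite ip_suml //.
have lk : linear_on U (koszul x y : V -> R^o).
  move=> a u v uU vU; rewrite /koszul /= (ip_linear_onr (brU xU yU)) //.
  rewrite (br_linearr yU) // (lie_linear lieU) //.
  by rewrite !(ip_linear ipU) ?brU //=; rewrite /GRing.scale /=; field.
rewrite {2}(frame zU) (linear_on_sum _ lk) //.
by apply: eq_bigr => i _; rewrite (ip_sym ipU zU) // mulrAC.
Qed.

Lemma nablaU x y : nabla x y \in U.
Proof. exact: mem_frame_sum. Qed.

Lemma ip_inj : {in U &, forall x y, {in U, forall z, ip x z = ip y z} -> x = y}.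
Proof.
move=> x y xU yU xy; rewrite (frame xU) (frame yU).
by apply: eq_bigr => i _; rewrite xy.
Qed.

Lemma koszul_levi_civita : levi_civita br ip U nabla.
Proof.
split=> [x y xU yU|a x y z xU yU zU|a x y z xU yU zU|x y xU yU|x y z xU yU zU].
- exact: nablaU.
- apply: ip_inj => [||t tU]; rewrite ?nablaU ?memvD ?memvZ ?nablaU //.
  rewrite (ip_linear ipU) ?nablaU // !koszulE ?memvD ?memvZ // /koszul.
  rewrite (lie_linear lieU) // (br_linearr tU) // !(ip_linear ipU) ?brU //.
  by rewrite (ip_linear_onr (brU zU tU)) //= /GRing.scale /=; field.
- apply: ip_inj => [||t tU]; rewrite ?nablaU ?memvD ?memvZ ?nablaU //.
  rewrite (ip_linear ipU) ?nablaU // !koszulE ?memvD ?memvZ // /koszul.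
  rewrite (lie_linear lieU) // (br_linearr zU) // !(ip_linear ipU) ?brU //.
  by rewrite (ip_linear_onr (brU tU zU)) //= /GRing.scale /=; field.
- apply: ip_inj => [||t tU]; rewrite ?memvB ?nablaU ?brU //.
  rewrite ipDl ?memvN ?nablaU // ipNl ?nablaU // !koszulE // /koszul.
  rewrite (br_skew xU yU) (br_skew xU tU) (br_skew yU tU) !ipNl ?brU //.
  by rewrite (br_skew tU yU) !ipNl ?brU //; field.
rewrite (ip_sym ipU yU) ?nablaU // !koszulE // /koszul.
rewrite (br_skew xU yU) (br_skew xU zU) (br_skew yU zU) !ipNl ?brU //.
by field.
Qed.

Let LC := koszul_levi_civita.

Lemma linear_nabla x : x \in U -> linear_on U (nabla x).
Proof. by move=> xU a y z yU zU; apply: (lc_linearr LC). Qed.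

Lemma linear_nablar x : x \in U -> linear_on U (nabla^~ x).
Proof. by move=> xU a y z yU zU; apply: (lc_linearl LC). Qed.

Lemma trace_onB (f g : V -> V) :
  trace_on U (fun z => f z - g z) = trace_on U f - trace_on U g.
Proof. by rewrite /trace_on -sumrB; apply: eq_bigr => i _; rewrite linearB. Qed.

Lemma eq_trace_on (f g : V -> V) :
  {in U, f =1 g} -> trace_on U f = trace_on U g.
Proof.
move=> fg; apply: eq_bigr => i _; congr (coord _ _ _); apply: fg.
by apply: vbasis_mem; rewrite mem_nth // size_tuple.
Qed.

(* With D_x z = nabla_z x one has [z, x] = D_x z - nabla_x z; the terms
   tr (nabla_x D_y) and tr (D_y nabla_x) cancel. *)
Lemma ricci_trace : {in U &, forall x y,
  ricci br U nabla x y =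
  trace_on U (nabla^~ (nabla x y)) - trace_on U (nabla^~ y \o nabla^~ x)}.
Proof.
move=> x y xU yU.
have NU := nablaU.
rewrite /ricci (@eq_trace_on _ (fun z => nabla z (nabla x y) - (nabla x \o nabla^~ y) z
    - ((nabla^~ y \o nabla^~ x) z - (nabla^~ y \o nabla x) z))); last first.
  move=> z zU; rewrite /curvature /=; congr (_ - _).
  rewrite -(lc_torsion_free LC) // addrC -scaleN1r (lc_linearl LC) //.
  by rewrite scaleN1r addrC.
rewrite !trace_onB (@trace_on_compC (nabla x)) //; first by ring.
all: by [apply: linear_nabla|apply: linear_nablar|move=> *; apply: nablaU].
Qed.

(** The three sums are the bracket term, the trace of ad x composed with the adjoint of ad y, and
    the Killing form tr (ad x ad y). The mean curvature term is added in [ricciE]. *)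
Definition ricci_sum (x y : V) : R :=
  (\sum_i \sum_j w i * w j *
     (ip (br (e i) (e j)) x * ip (br (e i) (e j)) y)) / 4
  - (\sum_i \sum_j w i * w j * (ip (br x (e i)) (e j) * ip (br y (e i)) (e j))) / 2
  - (\sum_i \sum_j w i * w j * (ip (br x (e i)) (e j) * ip (br y (e j)) (e i))) / 2.

(** By the Koszul formula D_x is -1/2 times the sum of the symmetric part ad x + (ad x)^T and a skew
    part read off from brackets of frame vectors. Symmetric times skew has trace zero, so only two
    products survive. *)
Lemma trace_nabla2 : {in U &, forall x y,
  - trace_on U (nabla^~ y \o nabla^~ x) = ricci_sum x y}.
Proof.
move=> x y xU yU; have [lx ly] := (linear_nablar xU, linear_nablar yU).
have NU := nablaU.
rewrite trace_on_comp // /ricci_sum.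
pose a i j := ip (br x (e i)) (e j); pose b i j := ip (br y (e i)) (e j).
pose s i j := ip (br (e i) (e j)) x; pose t i j := ip (br (e i) (e j)) y.
have sN i j : s i j = - s j i by rewrite /s br_skew // ipNl ?brU.
have tN i j : t i j = - t j i by rewrite /t br_skew // ipNl ?brU.
have aE i j : ip (nabla (e i) x) (e j) = - (a i j + a j i + s i j) / 2.
  rewrite koszulE // /koszul (br_skew xU) // ipNl ?brU // -/(a i j) -/(a j i).
  rewrite -/(s j i) sN; ring.
have bE i j : ip (nabla (e i) y) (e j) = - (b i j + b j i + t i j) / 2.
  rewrite koszulE // /koszul (br_skew yU) // ipNl ?brU // -/(b i j) -/(b j i).
  rewrite -/(t j i) tN; ring.
under eq_bigr => i _ do under eq_bigr => j _ do rewrite aE bE.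
rewrite -/a -/b -/s -/t.
pose S (F : I -> I -> R) := \sum_i \sum_j w i * w j * F i j.
have SD F G : S (fun i j => F i j + G i j) = S F + S G.
  rewrite /S -big_split; apply: eq_bigr => i _; rewrite -big_split.
  by apply: eq_bigr => j _; rewrite mulrDr.
have SZ c F : S (fun i j => c * F i j) = c * S F.
  rewrite /S mulr_sumr; apply: eq_bigr => i _; rewrite mulr_sumr.
  by apply: eq_bigr => j _; rewrite mulrCA.
have SC F : S (fun i j => F j i) = S F.
  rewrite /S exchange_big; apply: eq_bigr => i _; apply: eq_bigr => j _.
  by rewrite [w j * _]mulrC.
have eS F G : (forall i j, F i j = G i j) -> S F = S G.
  by move=> FG; apply: eq_bigr => i _; apply: eq_bigr => j _; rewrite FG.
rewrite -[LHS]/(- S (fun i j => - (a i j + a j i + s i j) / 2 * (- (b j i + b i j + t j i) / 2))).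
rewrite -[RHS]/(S (fun i j => s i j * t i j) / 4 - S (fun i j => a i j * b i j) / 2
   - S (fun i j => a i j * b j i) / 2).
pose as_ i j := a i j * (b i j + b j i).
pose skew i j := (b i j + b j i) * s i j - (a i j + a j i) * t i j.
rewrite (eS _ (fun i j => 4^-1 * (as_ i j + (as_ j i + (skew i j + (-1) * (s i j * t i j)))))); last first.
  by move=> i j; rewrite (tN j i) /as_ /skew; field.
rewrite SZ 3!SD (SC as_) SZ.
(* The mixed symmetric-skew terms change sign when the two summation indices are exchanged. *)
have -> : S skew = 0.
  have : S skew = - S skew.
    rewrite -{1}SC -mulN1r -SZ; apply: eS => i j.
    by rewrite /skew (sN j i) (tN j i); ring.
  by lra.
rewrite (eS as_ (fun i j => a i j * b i j + a i j * b j i)) ?SD => [|i j].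
  by field.
by rewrite /as_ mulrDr.
Qed.

(** [H] is the mean curvature vector, dual to u -> tr (ad u). Since nabla_v is skew it has no trace,
    so torsion-freeness turns the trace of z -> nabla_z v into - tr (ad v), that is - <H, v>. *)
Lemma ricciE (H : V) : H \in U ->
  {in U, forall u, \sum_i w i * ip (br u (e i)) (e i) = ip H u} ->
  {in U &, forall x y, ricci br U nabla x y =
     - (ip (br x y) H - ip (br y H) x + ip (br H x) y) / 2 + ricci_sum x y}.
Proof.
move=> HU HE x y xU yU; rewrite ricci_trace // trace_nabla2 //; congr (_ + _).
have NU := nablaU; rewrite trace_on_ip //; last exact: linear_nablar.
transitivity (- ip H (nabla x y)); last first.
  by rewrite (ip_sym ipU HU) // koszulE // /koszul mulNr.
rewrite -HE // -sumrN; apply: eq_bigr => i _.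
have := lc_torsion_free LC (eU i) (NU x y); move/eqP; rewrite subr_eq => /eqP->.
rewrite br_skew // ipDl ?memvN ?brU // ipNl ?brU //.
have := lc_metric LC (NU x y) (eU i) (eU i).
rewrite (ip_sym ipU (eU i)) // => H2.
have -> : ip (nabla (nabla x y) (e i)) (e i) = 0 by lra.
by rewrite addr0 mulrN.
Qed.

End MetricFrame.

(** * Solvable parts of block-triangular subalgebras of real matrices *)

Section Parabolic.
Context (R : realType) (N : nat) (l : 'I_N -> nat).
Implicit Types (x y z : 'M[R]_N).

Definition lie_mx x y : 'M[R]_N := x *m y - y *m x.

Definition upper x : Prop := forall p q, ~~ (l p < l q)%N -> x p q = 0.

Definition parabolic x : Prop :=
  [/\ forall p q, p != q -> ~~ (l p < l q)%N -> x p q = 0,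
      forall p q, l p = l q -> x p p = x q q
    & \sum_p x p p = 0].

Definition dot x y : R := \sum_p \sum_q x p q * y p q.
(** The second sum makes diagonal entries count twice, as the factor 2 on the abelian part of the
    metric requires. *)
Definition par_form x y : R := dot x y + \sum_p x p p * y p p.

Lemma upper_parabolic x : upper x -> parabolic x.
Proof.
move=> xu; split=> [p q _|p q _|]; first exact: xu.
  by rewrite !xu ?ltnn.
by rewrite big1 // => p _; rewrite xu ?ltnn.
Qed.

Lemma upper0 : upper 0. Proof. by move=> p q _; rewrite mxE. Qed.

Lemma parabolic0 : parabolic 0. Proof. exact: upper_parabolic upper0. Qed.

Lemma parabolic_lin c x y : parabolic x -> parabolic y -> parabolic (c *: x + y).
Proof.
move=> [x1 x2 x3] [y1 y2 y3]; split=> [p q pq a|p q e|].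
- by rewrite !mxE x1 // y1 // mulr0 addr0.
- by rewrite !mxE (x2 p q) ?(y2 p q).
under eq_bigr => p _ do rewrite !mxE.
by rewrite big_split /= -mulr_sumr x3 y3 mulr0 addr0.
Qed.

(** Diagonal blocks are scalar, so outside the strictly upper blocks a product has only the diagonal
    entries x_pp y_pp, and these are symmetric in the two factors. *)
Lemma lie_mx_upper x y : parabolic x -> parabolic y -> upper (lie_mx x y).
Proof.
have key u v p q : parabolic u -> parabolic v -> ~~ (l p < l q)%N ->
    (u *m v) p q = (p == q)%:R * (u p p * v p p).
  move=> [u1 _ _] [v1 _ _] npq; rewrite mxE (bigD1 p) //= big1 ?addr0.
    by have [<-|pq] := eqVneq p q; rewrite ?mul1r // v1 // mulr0 mul0r.
  move=> r rp; have [pr|npr] := boolP (l p < l r)%N; last first.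
    by rewrite u1 ?mul0r // eq_sym.
  rewrite v1 ?mulr0 //; last by lia.
  by apply: contraTneq pr => ->.
move=> px py p q npq; rewrite [lie_mx x y]/(x *m y - y *m x) mxE [X in _ + X]mxE.
by rewrite !key // [y p p * _]mulrC subrr.
Qed.

Lemma dot_par_form x y : upper x -> par_form x y = dot x y.
Proof.
by move=> xu; rewrite /par_form big1 ?addr0 // => p _; rewrite xu ?ltnn ?mul0r.
Qed.

Lemma par_formC x y : par_form x y = par_form y x.
Proof.
congr (_ + _); last by apply: eq_bigr => p _; rewrite mulrC.
by apply: eq_bigr => p _; apply: eq_bigr => q _; rewrite mulrC.
Qed.

Lemma par_form_linl c x y z : par_form (c *: x + y) z = c * par_form x z + par_form y z.
Proof.
rewrite /par_form /dot mulrDr addrACA !mulr_sumr; congr (_ + _); rewrite -big_split.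
  apply: eq_bigr => p _; rewrite mulr_sumr -big_split.
  by apply: eq_bigr => q _; rewrite !mxE mulrDl mulrA.
by apply: eq_bigr => p _; rewrite !mxE mulrDl mulrA.
Qed.

Lemma par_form_gt0 x : x != 0 -> 0 < par_form x x.
Proof.
move=> x0; apply: ltr_wpDr.
  by apply: sumr_ge0 => p _; rewrite -expr2 sqr_ge0.
have sq0 p q : 0 <= x p q * x p q by rewrite -expr2 sqr_ge0.
have sum0 p : 0 <= \sum_q x p q * x p q by apply: sumr_ge0.
rewrite lt_def sumr_ge0 // andbT; apply: contra x0 => /eqP d0.
apply/eqP/matrixP=> p q; rewrite mxE; apply/eqP.
rewrite -sqrf_eq0 expr2; apply/eqP.
have s0 := psumr_eq0P (fun p _ => sum0 p) d0 (i := p) isT.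
by rewrite (psumr_eq0P (fun q _ => sq0 p q) s0).
Qed.

Local Notation a p q := ((l p < l q)%N%:R : R).
Local Notation d p q := ((p == q)%:R : R).

Lemma sum_kron (i : 'I_N) (F : 'I_N -> R) : \sum_k d i k * F k = F i.
Proof.
rewrite (bigD1 i) //= eqxx mul1r big1 ?addr0 // => k ki.
by rewrite eq_sym (negPf ki) mul0r.
Qed.

(* Entries of the orthogonal projection to diagonal matrices that are
   trace-free and constant on the level sets of [l]. *)
Definition proj_coef (i p : 'I_N) : R :=
  (l i == l p)%:R / (\sum_q (l i == l q)%:R) - N%:R^-1.

Lemma proj_coefC i p : proj_coef i p = proj_coef p i.
Proof.
rewrite /proj_coef eq_sym; have [->|] := eqVneq (l p) (l i) => //.
by rewrite !mul0r.
Qed.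

Lemma level_gt0 i : 0 < \sum_q (l i == l q)%:R :> R.
Proof.
by rewrite (bigD1 i) //= eqxx ltr_wpDr ?ltr01 // sumr_ge0.
Qed.

(** The term in 1/N drops out because the trace is zero, and averaging over the level set of [i]
    returns the common diagonal value there. *)
Lemma proj_coefE x i : parabolic x -> \sum_p x p p * proj_coef i p = x i i.
Proof.
move=> [_ x2 x3]; under eq_bigr => p _ do rewrite mulrBr.
rewrite sumrB -[X in _ - X]mulr_suml x3 mul0r subr0.
under eq_bigr => p _ do rewrite mulrA.
rewrite -mulr_suml; apply: canLR (mulfK _) _; first exact/lt0r_neq0/level_gt0.
rewrite mulr_sumr; apply: eq_bigr => p _.
by have [/x2->//|] := eqVneq (l i) (l p); rewrite !mulr0.
Qed.

(* The matrix units above the diagonal blocks, and the projections of the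
   diagonal matrix units to the abelian part. *)
Definition frame_mx (k : 'I_N * 'I_N + 'I_N) : 'M[R]_N :=
  match k with
  | inl ij => a ij.1 ij.2 *: delta_mx ij.1 ij.2
  | inr i => diag_mx (\row_p proj_coef i p)
  end.

Lemma frame_inl_upper ij : upper (frame_mx (inl ij)).
Proof.
case: ij => i j p q npq; rewrite !mxE /=.
have [ei|_] := eqVneq p i; have [ej|_] := eqVneq q j; rewrite ?mulr0 //.
by rewrite -ei -ej (negPf npq) mul0r.
Qed.

Lemma frame_parabolic k : parabolic (frame_mx k).
Proof.
case: k => [ij|i]; first exact/upper_parabolic/frame_inl_upper.
split=> [p q pq _|p q e|] /=.
- by rewrite !mxE (negPf pq) mulr0n.
- by rewrite !mxE !eqxx /proj_coef e.
under eq_bigr => p _ do rewrite !mxE eqxx mulr1n /proj_coef.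
rewrite sumrB -mulr_suml divff ?sumr_const ?card_ord ?lt0r_neq0 ?level_gt0 //.
rewrite -[X in _ - X]mulr_natr mulVf ?subrr // pnatr_eq0 -lt0n.
exact: leq_ltn_trans (ltn_ord i).
Qed.

Lemma par_form_inl x i j : par_form x (frame_mx (inl (i, j))) = a i j * x i j.
Proof.
rewrite par_formC dot_par_form; last exact: frame_inl_upper.
rewrite /dot (bigD1 i) //= (bigD1 j) //= !mxE !eqxx mulr1.
rewrite big1 => [|q qj]; last first.
  by rewrite !mxE (negPf qj) andbF mulr0 mul0r.
rewrite big1 ?addr0 // => p pi; rewrite big1 // => q _.
by rewrite !mxE (negPf pi) mulr0 mul0r.
Qed.

Lemma par_form_inr x i : parabolic x -> par_form x (frame_mx (inr i)) = 2 * x i i.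
Proof.
move=> px; rewrite /par_form /dot (_ : \sum_p \sum_q _ = \sum_p x p p * proj_coef i p).
  under [X in _ + X]eq_bigr => p _ do rewrite !mxE eqxx mulr1n.
  by rewrite proj_coefE //; ring.
apply: eq_bigr => p _; rewrite (bigD1 p) //= big1 => [|q qp].
  by rewrite !mxE eqxx mulr1n addr0.
by rewrite !mxE eq_sym (negPf qp) mulr0n mulr0.
Qed.

(** Inverse squared norms, for kappa times [par_form], of the unprojected matrix units: kappa off
    the diagonal, 2 kappa on it. *)
Definition frame_weight (kappa : R) (k : 'I_N * 'I_N + 'I_N) : R :=
  if k is inl _ then kappa^-1 else (2 * kappa)^-1.

Lemma frame_mxP (kappa : R) x : kappa != 0 -> parabolic x ->
  x = \sum_k (frame_weight kappa k * (kappa * par_form x (frame_mx k))) *: frame_mx k.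
Proof.
move=> k0 px; rewrite big_sumType /=.
rewrite -(pair_bigA _ (fun i j => (kappa^-1 * (kappa * par_form x (frame_mx (inl (i, j))))) *:
   frame_mx (inl (i, j)))) /=.
under eq_bigr => i _ do under eq_bigr => j _ do
  rewrite par_form_inl mulKf // scalerA.
under [X in _ + X]eq_bigr => i _ do rewrite par_form_inr // invfM -mulrA mulKf // mulKf ?pnatr_eq0 //.
apply/matrixP=> p q; rewrite mxE !summxE.
under eq_bigr => i _ do rewrite summxE.
have [<-|pq] := eqVneq p q.
  rewrite big1 ?add0r => [|i _]; last first.
    rewrite big1 // => j _; rewrite !mxE.
    have [<-|] := eqVneq p i; have [<-|] := eqVneq p j; rewrite ?mulr0 //.
    by rewrite ltnn !mul0r.
  under eq_bigr => i _ do rewrite !mxE eqxx mulr1n proj_coefC.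
  by rewrite proj_coefE.
rewrite [X in _ + X]big1 ?addr0 => [|i _]; last by rewrite !mxE (negPf pq) mulr0n mulr0.
rewrite (bigD1 p) //= (bigD1 q) //= !mxE !eqxx mulr1 big1 => [|j jq]; last first.
  by rewrite !mxE (eq_sym q) (negPf jq) andbF mulr0.
rewrite big1 => [|i ip]; last first.
  by rewrite big1 // => j _; rewrite !mxE (eq_sym p) (negPf ip) mulr0.
have [px1 _ _] := px; rewrite !addr0.
by case: (boolP (l p < l q)%N) => [_|/px1->//]; rewrite ?mul1r ?mulr1 ?mulr0.
Qed.

Lemma mulmx_deltar x (i j k m : 'I_N) : (x *m delta_mx i j) k m = d j m * x k i.
Proof.
rewrite mxE (bigD1 i) //= mxE eqxx [m == j]eq_sym mulrC big1 ?addr0 // => r ri.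
by rewrite mxE (negPf ri) mulr0.
Qed.

Lemma mulmx_deltal x (i j k m : 'I_N) : (delta_mx i j *m x) k m = d i k * x j m.
Proof.
rewrite mxE (bigD1 j) //= mxE eqxx andbT [k == i]eq_sym big1 ?addr0 // => r rj.
by rewrite mxE (negPf rj) andbF mul0r.
Qed.

Lemma lie_mx_inl x i j k m :
  lie_mx x (frame_mx (inl (i, j))) k m = a i j * (d j m * x k i - d i k * x j m).
Proof.
rewrite /lie_mx /= -scalemxAr -scalemxAl -scalerBr mxE; congr (_ * _).
by rewrite -mulmx_deltar -mulmx_deltal !mxE.
Qed.

Lemma lie_mx_inr x i k m :
  lie_mx x (frame_mx (inr i)) k m = x k m * (proj_coef i m - proj_coef i k).
Proof.
rewrite /lie_mx /= mul_mx_diag mul_diag_mx !mxE; ring.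
Qed.

Lemma dotE x y : dot x y = \tr (x *m y^T).
Proof.
by apply: eq_bigr => p _; rewrite mxE; apply: eq_bigr => q _; rewrite mxE.
Qed.

Lemma dot_deltal (i j : 'I_N) x : dot (delta_mx i j) x = x i j.
Proof.
rewrite /dot (bigD1 i) //= (bigD1 j) //= !mxE !eqxx mul1r.
rewrite big1 => [|q qj]; last by rewrite !mxE (negPf qj) andbF mul0r.
rewrite big1 ?addr0 // => p pi; rewrite big1 // => q _.
by rewrite !mxE (negPf pi) mul0r.
Qed.

Lemma dotZl c x y : dot (c *: x) y = c * dot x y.
Proof. by rewrite !dotE -scalemxAl mxtraceZ. Qed.

Lemma dotBl x y z : dot (x - y) z = dot x z - dot y z.
Proof. by rewrite !dotE mulmxBl raddfB. Qed.

Lemma par_form_lie_inr x i j : parabolic x ->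
  par_form (lie_mx x (frame_mx i)) (frame_mx (inr j)) = 0.
Proof.
move=> px; have ux := lie_mx_upper px (frame_parabolic i).
by rewrite par_form_inr ?ux ?ltnn ?mulr0 //; apply: upper_parabolic.
Qed.

Lemma par_form_comm_inl_inl x i j k m : parabolic x ->
  par_form (lie_mx x (frame_mx (inl (i, j)))) (frame_mx (inl (k, m))) =
  a i j * a k m * (d j m * x k i - d i k * x j m).
Proof. by move=> px; rewrite par_form_inl lie_mx_inl mulrA [a k m * _]mulrC. Qed.

Lemma par_form_comm_inr_inl x i k m :
  par_form (lie_mx x (frame_mx (inr i))) (frame_mx (inl (k, m))) =
  a k m * x k m * (proj_coef i m - proj_coef i k).
Proof. by rewrite par_form_inl lie_mx_inr mulrA. Qed.

Lemma par_form_bracket_inl_inl x i j k m :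
  par_form (lie_mx (frame_mx (inl (i, j))) (frame_mx (inl (k, m)))) x =
  a i j * a k m * (d j k * x i m - d i m * x k j).
Proof.
rewrite dot_par_form; last by apply: lie_mx_upper; apply: frame_parabolic.
rewrite /lie_mx /= -!scalemxAr -!scalemxAl !scalerA [a k m * _]mulrC -scalerBr.
rewrite !mul_delta_mx_cond dotZl dotBl -[_ *+ (j == k)]scaler_nat -[_ *+ (m == i)]scaler_nat !dotZl.
by rewrite !dot_deltal [m == i]eq_sym.
Qed.

Lemma par_form_bracket_inl_inr x i j k :
  par_form (lie_mx (frame_mx (inl (i, j))) (frame_mx (inr k))) x =
  a i j * x i j * (proj_coef k j - proj_coef k i).
Proof.
rewrite dot_par_form; last by apply: lie_mx_upper; apply: frame_parabolic.
rewrite [lie_mx _ _](_ : _ = (proj_coef k j - proj_coef k i) *: frame_mx (inl (i, j))).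
  by rewrite dotZl /= dotZl dot_deltal mulrC.
apply/matrixP=> p q; rewrite lie_mx_inr !mxE.
have [->|_] := eqVneq p i; have [->|_] := eqVneq q j; rewrite ?mulr0 ?mul0r //=.
by rewrite mulrC.
Qed.

Lemma lie_mxC x y : lie_mx y x = - lie_mx x y.
Proof. by rewrite /lie_mx opprB. Qed.

Lemma par_form_bracket_inr_inl x i j k :
  par_form (lie_mx (frame_mx (inr k)) (frame_mx (inl (i, j)))) x =
  - (a i j * x i j * (proj_coef k j - proj_coef k i)).
Proof.
rewrite -par_form_bracket_inl_inr lie_mxC !dot_par_form -?scaleN1r ?dotZl ?mulN1r //.
- by apply: lie_mx_upper; apply: frame_parabolic.
- by rewrite scaleN1r -lie_mxC; apply: lie_mx_upper; apply: frame_parabolic.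
Qed.

Lemma par_form_bracket_inr_inr x i k :
  par_form (lie_mx (frame_mx (inr i)) (frame_mx (inr k))) x = 0.
Proof.
have -> : lie_mx (frame_mx (inr i)) (frame_mx (inr k)) = 0.
  by rewrite /lie_mx /= !mulmx_diag; apply/eqP; rewrite subr_eq0; apply/eqP;
     congr diag_mx; apply/rowP=> p; rewrite !mxE mulrC.
by rewrite dot_par_form ?dotE ?mul0mx ?mxtrace0 //; apply: upper0.
Qed.

End Parabolic.

(** * Einstein property and solvability of an algebra with a parabolic matrix model *)

Section ParabolicEinstein.
Context (R : realType) (N : nat) (l : 'I_N -> nat).
Context (V : vectType R) (U : {vspace V}) (br : V -> V -> V) (ip : V -> V -> R).
Variables (Phi : {linear 'M[R]_N -> V}) (kappa : R).
Hypothesis kappa_gt0 : 0 < kappa.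
Hypothesis memU : forall u, u \in U <-> exists2 x, parabolic l x & u = Phi x.
Hypothesis brPhi : forall x y, br (Phi x) (Phi y) = Phi (lie_mx x y).
Hypothesis ipPhi : forall x y, parabolic l x -> parabolic l y ->
  ip (Phi x) (Phi y) = kappa * par_form x y.

Local Notation a p q := ((l p < l q)%N%:R : R).
Local Notation d p q := ((p == q)%:R : R).
Implicit Types (x y z : 'M[R]_N).
Local Arguments frame_mx : simpl never.
Local Notation K := ('I_N * 'I_N + 'I_N)%type.
Local Notation e := (fun k : K => Phi (frame_mx R l k)).
Local Notation w := (frame_weight kappa).

Let kappa_neq0 : kappa != 0. Proof. exact: lt0r_neq0. Qed.

Lemma parabolic_br x y : parabolic l x -> parabolic l y -> parabolic l (lie_mx x y).
Proof. by move=> px py; apply/upper_parabolic/lie_mx_upper. Qed.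

Lemma mem_Phi x : parabolic l x -> Phi x \in U.
Proof. by move=> px; apply/memU; exists x. Qed.

Lemma parabolic_lie : lie_algebra br U.
Proof.
split.
- move=> _ _ /memU[x px ->] /memU[y py ->].
  by rewrite brPhi; apply/mem_Phi/parabolic_br.
- move=> c _ _ _ /memU[x _ ->] /memU[y _ ->] /memU[z _ ->].
  rewrite -linearP !brPhi -linearP; congr (Phi _).
  rewrite /lie_mx mulmxDl mulmxDr -scalemxAl -scalemxAr scalerBr.
  by rewrite opprD addrACA.
- by move=> _ /memU[x _ ->]; rewrite brPhi /lie_mx subrr linear0.
move=> _ _ _ /memU[x _ ->] /memU[y _ ->] /memU[z _ ->].
rewrite !brPhi -!linearD -[RHS](linear0 Phi); congr (Phi _).
rewrite /lie_mx !mulmxBl !mulmxBr !mulmxA !opprB; apply/matrixP=> p q.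
by rewrite !mxE; ring.
Qed.

Lemma parabolic_br_skew : {in U &, forall u v, br v u = - br u v}.
Proof.
move=> _ _ /memU[x _ ->] /memU[y _ ->].
by rewrite !brPhi lie_mxC raddfN.
Qed.

Lemma parabolic_ip : inner_product ip U.
Proof.
split.
- move=> c _ _ _ /memU[x px ->] /memU[y py ->] /memU[z pz ->].
  rewrite -linearP !ipPhi //; last exact: parabolic_lin.
  by rewrite par_form_linl mulrDr mulrCA.
- by move=> _ _ /memU[x px ->] /memU[y py ->]; rewrite !ipPhi // par_formC.
move=> _ /memU[x px ->] nz; rewrite ipPhi // mulr_gt0 // par_form_gt0 //.
by apply: contraNneq nz => ->; rewrite linear0.
Qed.

Lemma frameU k : e k \in U.
Proof. exact/mem_Phi/frame_parabolic. Qed.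

Lemma parabolic_frame : {in U, forall u, u = \sum_k (w k * ip u (e k)) *: e k}.
Proof.
move=> _ /memU[x px ->]; rewrite {1}(frame_mxP kappa_neq0 px) linear_sum.
apply: eq_bigr => k _; rewrite linearZ ipPhi //; exact: frame_parabolic.
Qed.

Lemma frame_sum (F : K -> R) : \sum_k F k =
  \sum_i \sum_j F (inl (i, j)) + \sum_i F (inr i).
Proof.
rewrite big_sumType (pair_bigA _ (fun i j => F (inl (i, j)))); congr (_ + _).
by apply: eq_bigr => -[].
Qed.

Lemma frame_sum2 (F : K -> K -> R) : \sum_k \sum_k' F k k' =
  \sum_i \sum_j \sum_k \sum_m F (inl (i, j)) (inl (k, m))
  + \sum_k \sum_i \sum_j (F (inl (i, j)) (inr k) + F (inr k) (inl (i, j)))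
  + \sum_i \sum_k F (inr i) (inr k).
Proof.
rewrite frame_sum; under eq_bigr => i _ do under eq_bigr => j _ do rewrite frame_sum.
under [X in _ + X]eq_bigr => i _ do rewrite frame_sum.
under eq_bigr => i _ do rewrite big_split /=.
rewrite !big_split /= -!addrA; congr (_ + _); rewrite !addrA; congr (_ + _).
under [RHS]eq_bigr => k _ do under eq_bigr => i _ do rewrite big_split /=.
under [RHS]eq_bigr => k _ do rewrite big_split /=.
rewrite big_split /=; congr (_ + _).
under eq_bigr => i _ do rewrite exchange_big /=.
by rewrite exchange_big.
Qed.

(** * Evaluation of the three Ricci sums on the frame *)

Section RicciSum.
Variables (x y : 'M[R]_N).
Hypotheses (px : parabolic l x) (py : parabolic l y).

Definition diag_term : R :=
  \sum_k \sum_i \sum_j a i j * (x i j * y i j) *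
    (proj_coef R l k j - proj_coef R l k i) ^+ 2.
Definition bracket_term : R :=
  \sum_i \sum_j \sum_m a i j * a j m * (x i m * y i m).
(** The sum of alpha(x) alpha(y) over the weights alpha of the matrix units above the blocks;
    [ad_ad_sum] identifies it with tr (ad x ad y). *)
Definition root_term : R :=
  \sum_i \sum_j a i j * ((x i i - x j j) * (y i i - y j j)).
Definition ad_term : R :=
  \sum_i \sum_j a i j * (\sum_k a k i * (x k i * y k i) + \sum_m a j m * (x j m * y j m)).

Let aa p q : a p q * a p q = a p q.
Proof. by rewrite -natrM mulnb andbb. Qed.

Let pF k : parabolic l (frame_mx R l k) := frame_parabolic R l k.

(* [diag_term], which involves the sizes of the diagonal blocks, cancels between
   [bracket_sum] and [ad_adT_sum]. *)
Lemma bracket_sum :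
  \sum_k \sum_k' w k * w k' *
     (ip (br (e k) (e k')) (Phi x) * ip (br (e k) (e k')) (Phi y)) =
  2 * bracket_term + diag_term.
Proof.
have E u v z : parabolic l z ->
    ip (br (Phi (frame_mx R l u)) (Phi (frame_mx R l v))) (Phi z) =
    kappa * par_form (lie_mx (frame_mx R l u) (frame_mx R l v)) z.
  by move=> pz; rewrite brPhi ipPhi //; apply: parabolic_br.
rewrite frame_sum2 [X in _ + X]big1 ?addr0; last first.
  by move=> i _; rewrite big1 // => k _; rewrite E // par_form_bracket_inr_inr mulr0 mul0r mulr0.
congr (_ + _); last first.
  apply: eq_bigr => k _; apply: eq_bigr => i _; apply: eq_bigr => j _.
  rewrite !E // !par_form_bracket_inl_inr !par_form_bracket_inr_inl /=.
  rewrite -[in RHS](aa i j); field.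
  exact: kappa_neq0.
(* The two matrix products in a bracket of matrix units cannot both be nonzero, as that would put i
   before j and j before i. The cross terms thus vanish, and each order of multiplication
   contributes one [bracket_term]. *)
transitivity (\sum_i \sum_j \sum_k \sum_m
   (d j k * (a i j * a k m * (x i m * y i m)) +
    d i m * (a i j * a k m * (x k j * y k j)))).
  apply: eq_bigr => i _; apply: eq_bigr => j _; apply: eq_bigr => k _; apply: eq_bigr => m _.
  rewrite !E // !par_form_bracket_inl_inl /=.
  transitivity ((a i j * a i j) * (a k m * a k m) *
      ((d j k * x i m - d i m * x k j) * (d j k * y i m - d i m * y k j))).
    by field; exact: kappa_neq0.
  rewrite !aa; have [<-|_] := eqVneq j k; have [<-|_] := eqVneq i m; rewrite /=; try ring.
  have -> : a i j * a j i = 0 by rewrite -natrM mulnb; case: ltngtP.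
  by ring.
have -> : 2 * bracket_term = bracket_term + bracket_term by ring.
under eq_bigr => i _ do under eq_bigr => j _ do under eq_bigr => k _ do
  rewrite big_split /= -mulr_sumr sum_kron.
under eq_bigr => i _ do under eq_bigr => j _ do rewrite big_split /= sum_kron.
under eq_bigr => i _ do rewrite big_split /=.
rewrite big_split /=; congr (_ + _).
under eq_bigr => i _ do rewrite exchange_big /=.
rewrite exchange_big /=; apply: eq_bigr => k _; apply: eq_bigr => i _.
by apply: eq_bigr => j _; ring.
Qed.

Let Ead u v z : parabolic l z ->
  ip (br (Phi z) (Phi (frame_mx R l u))) (Phi (frame_mx R l v)) =
  kappa * par_form (lie_mx z (frame_mx R l u)) (frame_mx R l v).
Proof. by move=> pz; rewrite brPhi ipPhi //; apply: parabolic_br. Qed.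

Lemma ad_adT_sum :
  \sum_k \sum_k' w k * w k' *
     (ip (br (Phi x) (e k)) (e k') * ip (br (Phi y) (e k)) (e k')) =
  root_term + ad_term + diag_term / 2.
Proof.
rewrite frame_sum2 [X in _ + X]big1 ?addr0; last first.
  by move=> i _; rewrite big1 // => k _; rewrite Ead // par_form_lie_inr // mulr0 mul0r mulr0.
congr (_ + _); last first.
  rewrite mulr_suml; apply: eq_bigr => k _; rewrite mulr_suml; apply: eq_bigr => i _.
  rewrite mulr_suml; apply: eq_bigr => j _.
  rewrite !Ead // par_form_lie_inr // !par_form_comm_inr_inl /=.
  rewrite -[in RHS](aa i j); field.
  exact: kappa_neq0.
rewrite -big_split; apply: eq_bigr => i _; rewrite -big_split; apply: eq_bigr => j _ /=.
transitivity (\sum_k \sum_m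
   (d j m * (a i j * a k m * (x k i * y k i)) +
    d i k * (a i j * a k m * (x j m * y j m) -
    d j m * (a i j * a k m * (x k i * y j m + x j m * y k i))))).
  apply: eq_bigr => k _; apply: eq_bigr => m _.
  rewrite !Ead // !par_form_comm_inl_inl //=.
  transitivity ((a i j * a i j) * (a k m * a k m) *
      ((d j m * x k i - d i k * x j m) * (d j m * y k i - d i k * y j m))).
    by field; exact: kappa_neq0.
  rewrite !aa; case: (j == m); case: (i == k); rewrite /=; ring.
under [LHS]eq_bigr => k _ do rewrite big_split /= sum_kron -mulr_sumr.
rewrite big_split /= sum_kron sumrB sum_kron aa.
have [[x1 _ _] [y1 _ _]] := (px, py).
(* An entry x_ki is nonzero only for k = i or for k in an earlier block than i, and then k precedes
   j automatically. The case k = i feeds [root_term], the other one [ad_term]. *)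
have -> : \sum_k a i j * a k j * (x k i * y k i) =
    \sum_k a i j * (d i k * (x k i * y k i) + a k i * (x k i * y k i)).
  apply: eq_bigr => k _; have [<-|ik] := eqVneq i k.
    by rewrite ltnn aa /=; ring.
  case: (boolP (l k < l i)%N) => [ki|/x1->]; rewrite ?(eq_sym k) //; last by rewrite /=; ring.
  case: (boolP (l i < l j)%N) => [ij|_]; last by rewrite /=; ring.
  by rewrite (ltn_trans ki ij) /=; ring.
have -> : \sum_m a i j * a i m * (x j m * y j m) =
    \sum_m a i j * (d j m * (x j m * y j m) + a j m * (x j m * y j m)).
  apply: eq_bigr => m _; have [<-|jm] := eqVneq j m.
    by rewrite ltnn aa /=; ring.
  case: (boolP (l j < l m)%N) => [jm'|/x1->] //; last by rewrite /=; ring.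
  case: (boolP (l i < l j)%N) => [ij|_]; last by rewrite /=; ring.
  by rewrite (ltn_trans ij jm') /=; ring.
by rewrite -!mulr_sumr !big_split /= !sum_kron; ring.
Qed.

(** Only diagonal entries of x and y contribute: for p different from q, block triangularity forbids
    x_pq and y_qp to be both nonzero. *)
Lemma ad_ad_sum :
  \sum_k \sum_k' w k * w k' *
     (ip (br (Phi x) (e k)) (e k') * ip (br (Phi y) (e k')) (e k)) =
  root_term.
Proof.
rewrite frame_sum2 [X in _ + X]big1 ?addr0; last first.
  by move=> i _; rewrite big1 // => k _; rewrite Ead // par_form_lie_inr // mulr0 mul0r mulr0.
rewrite [X in _ + X]big1 ?addr0; last first.
  move=> i _; rewrite big1 // => j _; rewrite big1 // => k _.
  rewrite !Ead // par_form_lie_inr // (par_form_lie_inr _ _ py).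
  by rewrite !(mulr0, mul0r) addr0.
apply: eq_bigr => i _; apply: eq_bigr => j _ /=.
have [[x1 _ _] [y1 _ _]] := (px, py).
have xy0 p q : x p q * y q p = d p q * (x p p * y p p).
  have [<-|pq] := eqVneq p q; first by rewrite /=; ring.
  case: (boolP (l p < l q)%N) => [lpq|/x1->//]; last by rewrite /=; ring.
  rewrite y1 1?eq_sym //=; [ring|lia].
transitivity (\sum_k \sum_m
   (d j m * (d i k * (a i j * a k m * (x i i * y i i + x j j * y j j - x i i * y j j - x j j * y i i))))).
  apply: eq_bigr => k _; apply: eq_bigr => m _.
  rewrite !Ead // !par_form_comm_inl_inl //=.
  transitivity ((a i j * a i j) * (a k m * a k m) *
      ((d j m * x k i - d i k * x j m) * (d m j * y i k - d k i * y m j))).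
    by field; exact: kappa_neq0.
  rewrite !aa (eq_sym m) (eq_sym k); have [<-|jm] := eqVneq j m;
    have [<-|ik] := eqVneq i k; rewrite /=; try ring.
  - have xy := xy0 k i; rewrite eq_sym (negPf ik) mul0r in xy; ring: xy.
  - have xy := xy0 j m; rewrite (negPf jm) mul0r in xy; ring: xy.
under [LHS]eq_bigr => k _ do rewrite sum_kron.
by rewrite sum_kron aa; ring.
Qed.

Lemma parabolic_ricci_sum :
  ricci_sum br ip e w (Phi x) (Phi y) = bracket_term / 2 - root_term - ad_term / 2.
Proof. by rewrite /ricci_sum bracket_sum ad_adT_sum ad_ad_sum; field. Qed.

End RicciSum.

Definition mean_coef (p : 'I_N) : R := \sum_j (a p j - a j p).

(** Matrix of the mean curvature vector. tr (ad x) is the sum of [mean_coef p] times x_pp, and the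
    denominator 2 kappa undoes the doubled weight of the diagonal in the metric. *)
Definition mean_mx : 'M[R]_N := diag_mx (\row_p (mean_coef p / (2 * kappa))).

Lemma mean_parabolic : parabolic l mean_mx.
Proof.
split=> [p q pq _|p q pq|].
- by rewrite !mxE (negPf pq) mulr0n.
- by rewrite !mxE !eqxx /mean_coef pq.
under eq_bigr => p _ do rewrite !mxE eqxx mulr1n.
rewrite -mulr_suml /mean_coef; under eq_bigr => p _ do rewrite sumrB.
by rewrite sumrB [X in _ - X]exchange_big subrr mul0r.
Qed.

Lemma par_form_diag x (v : 'rV[R]_N) :
  par_form x (diag_mx v) = 2 * \sum_p x p p * v 0 p.
Proof.
rewrite /par_form /dot (_ : \sum_p \sum_q _ = \sum_p x p p * v 0 p).
  by under [X in _ + X]eq_bigr => p _ do rewrite !mxE eqxx mulr1n; ring.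
apply: eq_bigr => p _; rewrite (bigD1 p) //= big1 => [|q qp].
  by rewrite !mxE eqxx mulr1n addr0.
by rewrite !mxE eq_sym (negPf qp) mulr0n mulr0.
Qed.

Lemma trace_ad_mean : {in U, forall u,
  \sum_k w k * ip (br u (e k)) (e k) = ip (Phi mean_mx) u}.
Proof.
move=> _ /memU[x px ->]; have pf := frame_parabolic R l.
under eq_bigr => k _ do rewrite brPhi (ipPhi (parabolic_br px (pf k)) (pf k)).
rewrite frame_sum [X in _ + X]big1 ?addr0; last first.
  by move=> i _; rewrite par_form_lie_inr // !mulr0.
rewrite ipPhi //; last exact: mean_parabolic.
rewrite par_formC par_form_diag mulrA mulr_sumr /=.
transitivity (\sum_i \sum_j a i j * (x i i - x j j)).
  apply: eq_bigr => i _; apply: eq_bigr => j _.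
  rewrite par_form_inl lie_mx_inl !eqxx /=.
  have aa : a i j * a i j = a i j by rewrite -natrM mulnb andbb.
  by rewrite -[in RHS]aa; field; exact: kappa_neq0.
transitivity (\sum_i mean_coef i * x i i); last first.
  by apply: eq_bigr => i _; rewrite mxE; field; exact: kappa_neq0.
under eq_bigr => i _ do under eq_bigr => j _ do rewrite mulrBr.
under eq_bigr => i _ do rewrite sumrB.
rewrite sumrB [X in _ - X]exchange_big /= -sumrB; apply: eq_bigr => i _.
by rewrite /mean_coef mulr_suml -sumrB; apply: eq_bigr => j _; rewrite mulrBl.
Qed.

Lemma par_form_mean x y : parabolic l x -> parabolic l y ->
  par_form (lie_mx x mean_mx) y =
  \sum_p \sum_q a p q * (x p q * y p q) * (mean_coef q - mean_coef p) / (2 * kappa).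
Proof.
move=> px py; rewrite (dot_par_form _ (lie_mx_upper px mean_parabolic)).
apply: eq_bigr => p _; apply: eq_bigr => q _.
rewrite /lie_mx mul_mx_diag mul_diag_mx !mxE.
have [x1 _ _] := px; have [<-|pq] := eqVneq p q; first by ring.
case: (boolP (l p < l q)%N) => [_|/x1->//] /=; last by ring.
by field; exact: kappa_neq0.
Qed.

(** Pairs within one block contribute zero, so twice [root_term] is the sum over all pairs (p, q);
    when it is expanded, the mixed products vanish because both traces are zero. *)
Lemma sum_root_term x y : parabolic l x -> parabolic l y ->
  root_term x y = N%:R * \sum_p x p p * y p p.
Proof.
move=> [_ x2 x3] [_ y2 y3].
have: 2 * root_term x y = \sum_p \sum_q (x p p - x q q) * (y p p - y q q).
  have -> : 2 * root_term x y = root_term x y + root_term x y by ring.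
  rewrite {2}/root_term exchange_big /= -big_split; apply: eq_bigr => p _ /=.
  rewrite -big_split; apply: eq_bigr => q _ /=.
  case: (ltngtP (l p) (l q)) => [_|_|e] /=; try ring.
  by rewrite (x2 _ _ e); ring.
transitivity (2 * root_term x y / 2); first by field.
rewrite {}H.
under eq_bigr => p _.
  rewrite (_ : \sum_q _ = N%:R * (x p p * y p p) - x p p * \sum_q y q q - y p p * \sum_q x q q
     + \sum_q x q q * y q q); last first.
    rewrite !mulr_sumr -[N in N%:R]card_ord -sumr_const mulr_suml -!sumrB -big_split.
    by apply: eq_bigr => q _ /=; ring.
  rewrite x3 y3 !mulr0 !subr0; over.
rewrite big_split /= -mulr_sumr sumr_const card_ord -mulr_natl.
by field.
Qed.

Lemma parabolic_einstein : einstein br ip U.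
Proof.
exists (koszul_connection br ip e w).
  exact: (koszul_levi_civita parabolic_lie parabolic_ip frameU parabolic_frame parabolic_br_skew).
(* Read off from the abelian part, where Ricci gives -N and the metric 2 kappa times the sum of the
   x_pp y_pp. *)
exists (- N%:R / (2 * kappa)) => _ _ /memU[x px ->] /memU[y py ->].
rewrite (ricciE parabolic_lie parabolic_ip frameU parabolic_frame parabolic_br_skew
  (mem_Phi mean_parabolic) trace_ad_mean) ?mem_Phi // parabolic_ricci_sum //.
have pm := mean_parabolic.
have [x1 _ _] := px; have [y1 _ _] := py.
rewrite !brPhi [lie_mx mean_mx x]lie_mxC raddfN.
rewrite (ipNl parabolic_ip) ?mem_Phi //; last exact: parabolic_br.
rewrite !ipPhi //; try exact: parabolic_br.
(* [x, y] has zero diagonal, hence is orthogonal to the mean curvature vector. *)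
rewrite par_form_diag big1 => [|p _]; last first.
  by rewrite (lie_mx_upper px py) ?ltnn // mul0r.
rewrite !par_form_mean // sum_root_term //.
have dotxy : dot x y = \sum_p \sum_q a p q * (x p q * y p q) + \sum_p x p p * y p p.
  rewrite /dot -big_split; apply: eq_bigr => p _ /=.
  rewrite (bigD1 p) //= [X in _ = X + _](bigD1 p) //= ltnn mul0r add0r addrC.
  congr (_ + _); apply: eq_bigr => q qp.
  by case: (boolP (l p < l q)%N) => [_|npq] /=; rewrite ?mul1r // x1 ?mul0r ?mulr0 // eq_sym.
rewrite /par_form dotxy.
pose c p q := a p q * (x p q * y p q).
pose P1 := \sum_p \sum_q c p q * (mean_coef q - mean_coef p).
have meanE u v : (forall p q, u p q * v p q = x p q * y p q) ->
    \sum_p \sum_q a p q * (u p q * v p q) * (mean_coef q - mean_coef p) / (2 * kappa) =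
    P1 / (2 * kappa).
  move=> uv; rewrite mulr_suml; apply: eq_bigr => p _.
  by rewrite mulr_suml; apply: eq_bigr => q _; rewrite uv.
rewrite (meanE y x) => [|p q]; last exact: mulrC.
rewrite (meanE x y) //.
rewrite -[\sum_p \sum_q a p q * _]/(\sum_p \sum_q c p q).
(* The counts of j after q and before p in [ad_term] cancel against parts of
   [mean_coef q - mean_coef p]. At (p, q) each j is left with a p j * a j q - a p j - a j q, which
   equals -1 by inclusion-exclusion, as j lies after p or before q. *)
suff key : P1 + bracket_term x y - ad_term x y = - N%:R * \sum_p \sum_q c p q.
  transitivity ((P1 + bracket_term x y - ad_term x y) / 2 - N%:R * \sum_p x p p * y p p).
    by field; exact: kappa_neq0.
  by rewrite key; field; exact: kappa_neq0.
have -> : bracket_term x y = \sum_p \sum_q \sum_j c p q * (a p j * a j q).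
  rewrite /bracket_term; apply: eq_bigr => p _; rewrite exchange_big /=.
  apply: eq_bigr => q _; apply: eq_bigr => j _; rewrite /c.
  case: (boolP (l p < l j)%N) => [pj|_] /=; last by ring.
  case: (boolP (l j < l q)%N) => [jq|_] /=; last by ring.
  by rewrite (ltn_trans pj jq) /=; ring.
have -> : ad_term x y = \sum_p \sum_q \sum_j c p q * (a q j + a j p).
  rewrite /ad_term; under eq_bigr => i _ do under eq_bigr => j _ do rewrite mulrDr.
  under eq_bigr => i _ do rewrite big_split /=.
  under [RHS]eq_bigr => p _ do under eq_bigr => q _ do under eq_bigr => j _ do rewrite mulrDr.
  under [RHS]eq_bigr => p _ do under eq_bigr => q _ do rewrite big_split /=.
  under [RHS]eq_bigr => p _ do rewrite big_split /=.
  rewrite !big_split /=; congr (_ + _).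
    rewrite [RHS]exchange_big /=; apply: eq_bigr => i _; rewrite [RHS]exchange_big /=.
    apply: eq_bigr => j _; rewrite mulr_sumr; apply: eq_bigr => k _.
    by rewrite mulrC.
  rewrite exchange_big /=; apply: eq_bigr => p _; rewrite [RHS]exchange_big /=.
  apply: eq_bigr => i _; rewrite mulr_sumr; apply: eq_bigr => m _.
  by rewrite mulrC.
rewrite /P1 -big_split -sumrB mulr_sumr; apply: eq_bigr => p _ /=.
rewrite -big_split -sumrB mulr_sumr; apply: eq_bigr => q _ /=.
rewrite /mean_coef -sumrB mulr_sumr -big_split -sumrB /=.
rewrite -[N in RHS]card_ord -sumr_const -sumrN mulr_suml; apply: eq_bigr => j _.
rewrite /c; case: (boolP (l p < l q)%N) => [pq|_] /=; last by ring.
case: (boolP (l p < l j)%N) => pj /=; case: (boolP (l j < l q)%N) => jq /=.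
- have -> : (l j < l p)%N = false by lia.
  have -> : (l q < l j)%N = false by lia.
  by rewrite /=; ring.
- have -> : (l j < l p)%N = false by lia.
  by ring.
- have -> : (l q < l j)%N = false by lia.
  by ring.
by lia.
Qed.

(** * Solvability, through the filtration by label gaps *)

Definition height_space (k : nat) : {vspace 'M[R]_N} :=
  set_span [set x : 'M[R]_N | forall p q, ~~ (l p + k <= l q)%N -> x p q = 0].

Lemma mem_height k x :
  x \in height_space k <-> forall p q, ~~ (l p + k <= l q)%N -> x p q = 0.
Proof.
apply: mem_set_span => [p q _|c u v ul vl p q pq]; first by rewrite mxE.
by rewrite !mxE ul ?vl // mulr0 addr0.
Qed.

Lemma height_mul k x y : x \in height_space k.+1 -> y \in height_space k.+1 ->
  x *m y \in height_space k.+2.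
Proof.
move=> /mem_height xk /mem_height yk; apply/mem_height => p q pq.
rewrite mxE big1 // => r _; case: (boolP (l p + k.+1 <= l r)%N) => [pr|/xk->].
  by rewrite yk ?mulr0 //; lia.
by rewrite mul0r.
Qed.

(** The first bracket already makes the matrices strictly upper. From then on multiplication adds
    label gaps, so each further step raises the gap by at least one. *)
Lemma derived_height k :
  (derived_series br U k.+1 <= linfun Phi @: height_space k.+1)%VS.
Proof.
elim: k => [|k IHk]; apply: (set_spanP _).2 => _ [u [v [uU vU ->]]].
  move/memU: uU => [x px ->]; move/memU: vU => [y py ->].
  rewrite brPhi -(lfunE Phi) memv_img //; apply/mem_height => p q.
  by rewrite addn1; apply: lie_mx_upper.
move/subvP: IHk => IHk.
have /memv_imgP[x xk ->] := IHk _ uU; have /memv_imgP[y yk ->] := IHk _ vU.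
by rewrite !lfunE brPhi -(lfunE Phi) memv_img // /lie_mx memvB ?height_mul.
Qed.

Lemma parabolic_solvable : solvable_lie br U.
Proof.
(* At this step every nonzero entry would need a label gap larger than the largest label. *)
exists (\max_p l p).+1; apply/eqP; rewrite -subv0.
apply: subv_trans (derived_height _) _; apply/subvP=> _ /memv_imgP[x /mem_height xk ->].
suff -> : x = 0 by rewrite linear0 mem0v.
apply/matrixP=> p q; rewrite mxE xk //.
have := @leq_bigmax _ l q; lia.
Qed.

Lemma parabolic_einstein_solvmanifold : einstein_solvmanifold br ip U.
Proof.
split; [exact: parabolic_lie|exact: parabolic_ip|exact: parabolic_solvable|].
exact: parabolic_einstein.
Qed.

End ParabolicEinstein.

(** * The split quaternions *)

Section SplitQuaternion.
Context (R : realType) (n : nat).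
Local Notation M := 'M[R]_(n + n).
Local Notation MC := 'M[R[i]]_(n + n).
Implicit Types (x y : M) (z : MC).

Local Notation cx := (map_mx (real_complex R)).

Definition Jmx (F : nzRingType) : 'M[F]_(n + n) := block_mx 0 (- 1%:M) 1%:M 0.

Lemma mul_Jmx F : Jmx F *m Jmx F = - 1%:M.
Proof.
rewrite /Jmx mulmx_block !mul0mx !mulmx0 !mul1mx mulmx1 !addr0 add0r.
by rewrite (scalar_mx_block n n 1) opp_block_mx !oppr0.
Qed.

(* The parts of [x] that commute, resp. anticommute, with [Jmx]. *)
Definition evenp x : M := 2^-1 *: (x - Jmx R *m x *m Jmx R).
Definition oddp x : M := 2^-1 *: (x + Jmx R *m x *m Jmx R).

Lemma evenp_odd x : evenp x + oddp x = x.
Proof.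
rewrite /evenp /oddp -scalerDr addrCA addrNK -mulr2n -scaler_nat scalerA.
by rewrite mulVf ?scale1r // pnatr_eq0.
Qed.

Fact evenp_linear : linear evenp.
Proof.
move=> a x y; rewrite /evenp mulmxDr mulmxDl -scalemxAr -scalemxAl.
by rewrite opprD addrACA -scalerBr scalerDr !scalerA mulrC.
Qed.
HB.instance Definition _ := GRing.isLinear.Build R M M *:%R evenp evenp_linear.

Fact oddp_linear : linear oddp.
Proof.
move=> a x y; rewrite /oddp mulmxDr mulmxDl -scalemxAr -scalemxAl.
by rewrite addrACA -scalerDr [LHS]scalerDr !scalerA mulrC.
Qed.
HB.instance Definition _ := GRing.isLinear.Build R M M *:%R oddp oddp_linear.

Let mulJJ x y : (Jmx R *m x *m Jmx R) *m (Jmx R *m y *m Jmx R) =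
  - (Jmx R *m (x *m y) *m Jmx R).
Proof.
rewrite !mulmxA -[_ *m Jmx R *m Jmx R]mulmxA mul_Jmx.
by rewrite mulmxN mulmx1 !mulNmx.
Qed.

(** Since [Jmx] squares to -1, x -> - J x J is an involutive algebra automorphism, so its
    eigenspaces form a Z/2-grading of M_2n(R). *)
Lemma evenpM x y : evenp (x *m y) = evenp x *m evenp y + oddp x *m oddp y.
Proof.
rewrite /evenp /oddp -!scalemxAl -!scalemxAr !scalerA -scalerDr.
rewrite !(mulmxBl, mulmxBr, mulmxDl, mulmxDr) mulJJ.
set a := x *m y; set b := _ *m y; set c := x *m _; set e := Jmx R *m a *m _.
by apply/matrixP=> p q; rewrite !mxE; field.
Qed.

Lemma oddpM x y : oddp (x *m y) = evenp x *m oddp y + oddp x *m evenp y.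
Proof.
rewrite /evenp /oddp -!scalemxAl -!scalemxAr !scalerA -scalerDr.
rewrite !(mulmxBl, mulmxBr, mulmxDl, mulmxDr) mulJJ.
set a := x *m y; set b := _ *m y; set c := x *m _; set e := Jmx R *m a *m _.
by apply/matrixP=> p q; rewrite !mxE; field.
Qed.

(** An even real matrix with blocks P, -S; S, P becomes P, iS; iS, P, which has the quaternionic
    form with X = P and Y = iS, like the generators B and D. *)
Definition Tmx : MC := block_mx 1%:M 0 0 ('i%C)%:M.
Definition Tinv : MC := block_mx 1%:M 0 0 (- 'i%C)%:M.

Let ii : 'i%C * 'i%C = -1 :> R[i]. Proof. by rewrite -expr2 sqr_i. Qed.

Let i_neq0 : 'i%C != 0 :> R[i].
Proof. by rewrite eq_complex /= oner_eq0 andbF. Qed.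

Lemma TmxK : Tinv *m Tmx = 1%:M.
Proof.
rewrite /Tmx /Tinv mulmx_block !mul0mx !mulmx0 mulmx1 -scalar_mxM !addr0 add0r.
by rewrite mulNr ii opprK -scalar_mx_block.
Qed.

Definition conjT z : MC := Tmx *m z *m Tinv.

Fact conjT_linear : linear conjT.
Proof. by move=> a z t; rewrite /conjT mulmxDr mulmxDl -scalemxAr -scalemxAl. Qed.
HB.instance Definition _ := GRing.isLinear.Build R[i] MC MC *:%R conjT conjT_linear.

Lemma conjTM z t : conjT (z *m t) = conjT z *m conjT t.
Proof.
by rewrite /conjT !mulmxA -[Tmx *m z *m Tinv *m Tmx]mulmxA TmxK mulmx1.
Qed.

Lemma conjT_inj : injective conjT.
Proof.
move=> z t /(congr1 (fun u => Tinv *m u *m Tmx)); rewrite /conjT !mulmxA TmxK !mul1mx.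
by rewrite -!mulmxA TmxK !mulmx1.
Qed.

Definition embE x : MC := conjT (cx (evenp x)).
Definition embO x : MC := conjT (cx (oddp x)).

(* An embedding of associative algebras of M_2n(R) in M_2n(C) tensor C: since
   [Jmx] grades M_2n(R), the two factors ['i] and sqrt(-1) on the odd part
   multiply to a square root of 1 commuting with everything. Conjugation by
   [Tmx] puts both components in gl(n, H). *)
Definition Phi x : gC R n := (embE x, 'i%C *: embO x).

Lemma cmx_scaleE a (X : cmx R n) : a *: X = a%:C%C *: (X : MC).
Proof. by []. Qed.

Lemma cxZ (a : R) x : cx (a *: x) = a%:C%C *: cx x.
Proof. by rewrite map_mxZ. Qed.

Lemma embE_linear a x y : embE (a *: x + y) = a%:C%C *: embE x + embE y.
Proof. by rewrite /embE linearP map_mxD cxZ linearP. Qed.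

Lemma embO_linear a x y : embO (a *: x + y) = a%:C%C *: embO x + embO y.
Proof. by rewrite /embO linearP map_mxD cxZ linearP. Qed.

Lemma embEB x y : embE (x - y) = embE x - embE y.
Proof. by rewrite addrC -scaleN1r embE_linear rmorphN1 scaleN1r addrC. Qed.

Lemma embOB x y : embO (x - y) = embO x - embO y.
Proof. by rewrite addrC -scaleN1r embO_linear rmorphN1 scaleN1r addrC. Qed.

Lemma embEM x y : embE (x *m y) = embE x *m embE y + embO x *m embO y.
Proof. by rewrite /embE evenpM map_mxD !map_mxM linearD /= !conjTM. Qed.

Lemma embOM x y : embO (x *m y) = embE x *m embO y + embO x *m embE y.
Proof. by rewrite /embO oddpM map_mxD !map_mxM linearD /= !conjTM. Qed.

Fact Phi_linear : linear Phi.
Proof.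
move=> a x y; rewrite /Phi embE_linear embO_linear; congr pair.
by rewrite /= cmx_scaleE scalerDr !scalerA mulrC.
Qed.
HB.instance Definition _ := GRing.isLinear.Build R M (gC R n) *:%R Phi Phi_linear.

Lemma Phi_inj : injective Phi.
Proof.
move=> x y xy.
have /conjT_inj/map_mx_inj ex : embE x = embE y := congr1 fst xy.
have /(scalerI i_neq0)/conjT_inj/map_mx_inj ox : 'i%C *: embO x = 'i%C *: embO y :=
  congr1 snd xy.
by rewrite -[x]evenp_odd ex ox evenp_odd.
Qed.

Lemma brC_Phi x y : brC (Phi x) (Phi y) = Phi (lie_mx x y).
Proof.
suff [e o] : embE x *m embE y - embE y *m embE x -
      (('i%C *: embO x) *m ('i%C *: embO y) - ('i%C *: embO y) *m ('i%C *: embO x)) =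
      embE (lie_mx x y) /\
    (embE x *m ('i%C *: embO y) - ('i%C *: embO y) *m embE x) +
      (('i%C *: embO x) *m embE y - embE y *m ('i%C *: embO x)) =
      'i%C *: embO (lie_mx x y).
  by congr pair.
rewrite /lie_mx embEB embOB.
rewrite !embEM.
rewrite !embOM.
move: (embE x) (embE y) (embO x) (embO y) => a b c d.
rewrite -!scalemxAl.
rewrite -!scalemxAr.
rewrite !scalerA.
rewrite ii.
rewrite !scaleN1r.
rewrite -!scalerBr.
rewrite -scalerDr; split.
  by rewrite opprB opprK [- (d *m c) + _]addrC addrACA -opprD.
by rewrite addrACA -opprD; congr (_ *: (_ - _)); exact: addrC.
Qed.

Lemma Jmx_block (F : nzRingType) (P Q S T : 'M[F]_n) :
  Jmx F *m block_mx P Q S T *m Jmx F = block_mx (- T) S Q (- P).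
Proof.
rewrite /Jmx !mulmx_block !mul0mx !mulmx0 !mulmx1 !mul1mx !mulNmx !mulmxN !mulmx1 !mul1mx.
by rewrite !addr0 !add0r !opprK.
Qed.

Lemma evenp_block (P Q S T : 'M[R]_n) : evenp (block_mx P Q S T) =
  2^-1 *: block_mx (P + T) (Q - S) (S - Q) (T + P).
Proof. by rewrite /evenp Jmx_block opp_block_mx add_block_mx !opprK. Qed.

Lemma oddp_block (P Q S T : 'M[R]_n) : oddp (block_mx P Q S T) =
  2^-1 *: block_mx (P - T) (Q + S) (S + Q) (T - P).
Proof. by rewrite /oddp Jmx_block add_block_mx. Qed.

Lemma conjT_block (P Q S T : 'M[R[i]]_n) : conjT (block_mx P Q S T) =
  block_mx P (- 'i%C *: Q) ('i%C *: S) T.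
Proof.
rewrite /conjT /Tmx /Tinv !mulmx_block !mul0mx !mulmx0 !mul1mx !mulmx1.
rewrite !addr0 !add0r !mul_scalar_mx !mul_mx_scalar scalerA mulNr ii opprK.
by rewrite scale1r.
Qed.

(** The Kronecker product of the real matrix with rows (a, b), (c, d) and the unit E_jk: one
    split-quaternion entry. *)
Definition quat_mx (a b c d : R) (j k : 'I_n) : M :=
  block_mx (a *: delta_mx j k) (b *: delta_mx j k)
           (c *: delta_mx j k) (d *: delta_mx j k).

Lemma embE_quat a b c d j k : let D : 'M[R[i]]_n := delta_mx j k in
  embE (quat_mx a b c d j k) = (2^-1)%:C%C *:
    block_mx ((a + d)%:C%C *: D) (('i%C * (c - b)%:C%C) *: D)
             (('i%C * (c - b)%:C%C) *: D) ((d + a)%:C%C *: D).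
Proof.
move=> D; rewrite /embE /quat_mx evenp_block -!scalerBl -!scalerDl.
rewrite cxZ map_block_mx !map_mxZ map_delta_mx linearZ /= conjT_block !scalerA.
by rewrite -(opprB c b) rmorphN mulNr mulrN opprK.
Qed.

Lemma embO_quat a b c d j k : let D : 'M[R[i]]_n := delta_mx j k in
  'i%C *: embO (quat_mx a b c d j k) = (2^-1)%:C%C *:
    block_mx (('i%C * (a - d)%:C%C) *: D) ((b + c)%:C%C *: D)
             (- (b + c)%:C%C *: D) (('i%C * (d - a)%:C%C) *: D).
Proof.
move=> D; rewrite /embO /quat_mx oddp_block -!scalerBl -!scalerDl.
rewrite cxZ map_block_mx !map_mxZ map_delta_mx linearZ /= conjT_block.
rewrite [LHS]scalerA mulrC -[LHS]scalerA; congr (_ *: _).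
by rewrite scale_block_mx !scalerA [c + b]addrC mulrN ii opprK mul1r mulN1r.
Qed.

Local Notation s2 := (Num.sqrt (2 : R)).
(** The split-quaternion units scaled by the square root of 2. As 2 x 2 blocks, A and C square to +2
    and B to -2: the twist has reversed the signs of the squares of A and C. *)
Definition quatA := quat_mx s2 0 0 (- s2).
Definition quatB := quat_mx 0 (- s2) s2 0.
Definition quatC := quat_mx 0 s2 s2 0.
Definition quatD := quat_mx s2 0 0 s2.

Lemma delta_tt (F : pzRingType) (j k : 'I_n) : delta_mx (lshift n j) (lshift n k) =
  block_mx (delta_mx j k) 0 0 0 :> 'M[F]_(n + n).
Proof. by rewrite delta_mx_ushift delta_mx_lshift /block_mx row_mx0. Qed.
Lemma delta_tb (F : pzRingType) (j k : 'I_n) : delta_mx (lshift n j) (rshift n k) =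
  block_mx 0 (delta_mx j k) 0 0 :> 'M[F]_(n + n).
Proof. by rewrite delta_mx_ushift delta_mx_rshift /block_mx row_mx0. Qed.
Lemma delta_bt (F : pzRingType) (j k : 'I_n) : delta_mx (rshift n j) (lshift n k) =
  block_mx 0 0 (delta_mx j k) 0 :> 'M[F]_(n + n).
Proof. by rewrite delta_mx_dshift delta_mx_lshift /block_mx row_mx0. Qed.
Lemma delta_bb (F : pzRingType) (j k : 'I_n) : delta_mx (rshift n j) (rshift n k) =
  block_mx 0 0 0 (delta_mx j k) :> 'M[F]_(n + n).
Proof. by rewrite delta_mx_dshift delta_mx_rshift /block_mx row_mx0. Qed.

Let half2 (a : R) : (2^-1)%:C%C * (a + a)%:C%C = a%:C%C.
Proof. by rewrite -rmorphM; congr (_%:C)%C; field. Qed.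

Lemma Phi_quatA j k : Phi (quatA j k) = im_part (genA R j k).
Proof.
rewrite /Phi embE_quat embO_quat /im_part; congr pair.
  by rewrite subrr addrN addNr mulr0 !scale0r block_mx0 scaler0.
rewrite /genA delta_tt delta_bb opp_block_mx add_block_mx !scale_block_mx.
rewrite opprK addr0 oppr0 !scale0r !(subr0, add0r, scaler0) -opprD rmorphN.
rewrite !scalerA !mulrN scalerN scaleNr.
by rewrite !mulrA [_ * 'i%C]mulrC -mulrA half2.
Qed.

Lemma Phi_quatB j k : Phi (quatB j k) = re_part (genB R j k).
Proof.
rewrite /Phi embE_quat embO_quat /re_part; congr pair; last first.
  by rewrite subrr addNr mulr0 oppr0 !scale0r block_mx0 scaler0.
rewrite /genB delta_tb delta_bt add_block_mx !scale_block_mx.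
rewrite opprK addr0 !scale0r !(subr0, addr0, add0r, scaler0).
by rewrite !scalerA !mulrA [_ * 'i%C]mulrC -mulrA half2.
Qed.

Lemma Phi_quatC j k : Phi (quatC j k) = im_part (genC R j k).
Proof.
rewrite /Phi embE_quat embO_quat /im_part; congr pair.
  by rewrite subrr addr0 mulr0 !scale0r block_mx0 scaler0.
rewrite /genC delta_tb delta_bt opp_block_mx add_block_mx !scale_block_mx.
rewrite !(oppr0, addr0, add0r, mulr0, scale0r, scaler0).
by rewrite !scalerA mulrN half2 scaleNr scalerN.
Qed.

Lemma Phi_quatD j k : Phi (quatD j k) = re_part (genD R j k).
Proof.
rewrite /Phi embE_quat embO_quat /re_part; congr pair; last first.
  by rewrite subrr addr0 mulr0 oppr0 !scale0r block_mx0 scaler0.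
rewrite /genD delta_tt delta_bb add_block_mx !scale_block_mx.
rewrite subr0 mulr0 !scale0r !(subr0, addr0, add0r, scaler0).
by rewrite !scalerA half2.
Qed.

End SplitQuaternion.

(** * Real 2n x 2n matrices as n x n matrices over the split quaternions *)

Section QuatSpan.
Context (R : realType) (n : nat).
Local Notation M := 'M[R]_(n + n).
Local Notation s2 := (Num.sqrt (2 : R)).

Let s2_neq0 : s2 != 0.
Proof. by rewrite sqrtr_eq0 -ltNge ltr0n. Qed.

Lemma quat_mx_ul (a b c d : R) (j k p q : 'I_n) :
  quat_mx a b c d j k (lshift n p) (lshift n q) = a * ((p == j) && (q == k))%:R.
Proof. by rewrite /quat_mx block_mxEul !mxE. Qed.
Lemma quat_mx_ur (a b c d : R) (j k p q : 'I_n) :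
  quat_mx a b c d j k (lshift n p) (rshift n q) = b * ((p == j) && (q == k))%:R.
Proof. by rewrite /quat_mx block_mxEur !mxE. Qed.
Lemma quat_mx_dl (a b c d : R) (j k p q : 'I_n) :
  quat_mx a b c d j k (rshift n p) (lshift n q) = c * ((p == j) && (q == k))%:R.
Proof. by rewrite /quat_mx block_mxEdl !mxE. Qed.
Lemma quat_mx_dr (a b c d : R) (j k p q : 'I_n) :
  quat_mx a b c d j k (rshift n p) (rshift n q) = d * ((p == j) && (q == k))%:R.
Proof. by rewrite /quat_mx block_mxEdr !mxE. Qed.
Definition quat_mxE := (quat_mx_ul, quat_mx_ur, quat_mx_dl, quat_mx_dr).

Lemma quat_decomp (x : M) :
  let P j k := x (lshift n j) (lshift n k) in
  let Q j k := x (lshift n j) (rshift n k) in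
  let S j k := x (rshift n j) (lshift n k) in
  let T j k := x (rshift n j) (rshift n k) in
  x = \sum_j \sum_k
    (((P j k - T j k) / (2 * s2)) *: quatA R j k
    + ((S j k - Q j k) / (2 * s2)) *: quatB R j k
    + ((S j k + Q j k) / (2 * s2)) *: quatC R j k
    + ((P j k + T j k) / (2 * s2)) *: quatD R j k).
Proof.
move=> P Q S T; apply/matrixP=> p q.
have kron (F : 'I_n -> 'I_n -> R) i m :
    \sum_j \sum_k F j k * ((i == j) && (m == k))%:R = F i m.
  rewrite (bigD1 i) //= (bigD1 m) //= !eqxx mulr1 big1 => [|k km]; last first.
    by rewrite (eq_sym m) (negPf km) mulr0.
  rewrite addr0 big1 ?addr0 // => j ji.
  by rewrite big1 // => k _; rewrite (eq_sym i) (negPf ji) mulr0.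
have add (u v : M) i m : (u + v) i m = u i m + v i m by rewrite mxE.
have scale c (u : M) i m : (c *: u) i m = c * u i m by rewrite mxE.
rewrite summxE; under eq_bigr => j _ do rewrite summxE.
case: (split_ordP p) => i ->; case: (split_ordP q) => m ->.
- rewrite -[LHS](kron P); apply: eq_bigr => j _; apply: eq_bigr => k _.
  rewrite !add !scale !quat_mxE.
  by field.
- rewrite -[LHS](kron Q); apply: eq_bigr => j _; apply: eq_bigr => k _.
  rewrite !add !scale !quat_mxE.
  by field.
- rewrite -[LHS](kron S); apply: eq_bigr => j _; apply: eq_bigr => k _.
  rewrite !add !scale !quat_mxE.
  by field.
- rewrite -[LHS](kron T); apply: eq_bigr => j _; apply: eq_bigr => k _.
  rewrite !add !scale !quat_mxE.
  by field.
Qed.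

(* The two halves of 'I_(n + n) are the two rows of each quaternion. *)
Definition dbl (l : 'I_n -> nat) (p : 'I_(n + n)) : nat :=
  match split p with inl i => l i | inr i => l i end.

Lemma dbl_lshift l i : dbl l (lshift n i) = l i.
Proof. by rewrite /dbl (unsplitK (inl i)). Qed.

Lemma dbl_rshift l i : dbl l (rshift n i) = l i.
Proof. by rewrite /dbl (unsplitK (inr i)). Qed.

(** Reduces membership of strictly block upper matrices to the quaternion units. It serves both
    [Phi], into [attached_n'], and [Theta], into [nspace]. *)
Lemma upper_mem (l : 'I_n -> nat) (V : vectType R) (f : {linear M -> V})
    (T : {vspace V}) (x : M) :
  (forall j k, (l j < l k)%N ->
    [/\ f (quatA R j k) \in T, f (quatB R j k) \in T,
        f (quatC R j k) \in T & f (quatD R j k) \in T]) ->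
  upper (dbl l) x -> f x \in T.
Proof.
move=> fT ux; rewrite (quat_decomp x) linear_sum memv_suml // => j _.
rewrite linear_sum memv_suml // => k _.
have [/fT[fA fB fC fD]|njk] := boolP (l j < l k)%N.
  by rewrite !linearD !linearZ /= !memvD ?memvZ.
rewrite !ux ?dbl_lshift ?dbl_rshift // !(subrr, addr0, mul0r, scale0r).
by rewrite linear0 mem0v.
Qed.

Lemma quat_upper (l : 'I_n -> nat) (a b c d : R) j k : (l j < l k)%N ->
  upper (dbl l) (quat_mx a b c d j k).
Proof.
move=> jk p q.
have [[i Ep] [m Eq]] : (exists i, p = lshift n i \/ p = rshift n i) /\
    (exists m, q = lshift n m \/ q = rshift n m).
  by split; [case: (split_ordP p)|case: (split_ordP q)] => i ->; exists i; [left|right|left|right].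
have [-> ->] : dbl l p = l i /\ dbl l q = l m.
  by case: Ep Eq => -> [] ->; rewrite ?dbl_lshift ?dbl_rshift.
move=> npq; have nd : (i == j) && (m == k) = false.
  by apply: contraNF npq => /andP[/eqP-> /eqP->].
by case: Ep Eq => -> [] ->; rewrite quat_mxE nd mulr0.
Qed.

Definition dbl_diag (v : 'rV[R]_n) : M := diag_mx (row_mx v v).

Lemma lie_dbl_diag_quat v a b c d j k :
  lie_mx (dbl_diag v) (quat_mx a b c d j k) = (v 0 j - v 0 k) *: quat_mx a b c d j k.
Proof.
rewrite /lie_mx /dbl_diag diag_mx_row /quat_mx !mulmx_block !mul0mx !mulmx0 !addr0 !add0r.
have dl : diag_mx v *m delta_mx j k = v 0 j *: delta_mx j k.
  apply/matrixP=> p q; rewrite mul_diag_mx !mxE.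
  by have [->|_] := eqVneq p j; rewrite ?mulr0.
have dr : delta_mx j k *m diag_mx v = v 0 k *: delta_mx j k.
  apply/matrixP=> p q; rewrite mul_mx_diag !mxE mulrC.
  by have [->|_] := eqVneq q k; rewrite ?andbF ?mulr0.
rewrite -!scalemxAr -!scalemxAl dl dr opp_block_mx add_block_mx scale_block_mx.
by rewrite !scalerA -!scalerBl !mulrBl ![_ * v _ _]mulrC.
Qed.

Lemma Phi_dbl_diag (v : 'rV[R]_n) : Phi (dbl_diag v) = re_part (diag2 v).
Proof.
rewrite /Phi /dbl_diag diag_mx_row /embE /embO evenp_block oddp_block; congr pair; last first.
  by rewrite !subrr addr0 block_mx0 scaler0 map_mx0 linear0 scaler0.
have half2 (F : 'M[R]_n) : 2^-1 *: (F + F) = F.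
  by rewrite -mulr2n -scaler_nat scalerA mulVf ?scale1r // pnatr_eq0.
rewrite subrr scale_block_mx !half2 scaler0 map_block_mx !map_mx0 conjT_block !scaler0.
by rewrite !map_diag_mx /diag2 diag_mx_row.
Qed.

Lemma dbl_diag_linear a u v : dbl_diag (a *: u + v) = a *: dbl_diag u + dbl_diag v.
Proof.
rewrite /dbl_diag -linearP; congr diag_mx.
by rewrite scale_row_mx add_row_mx.
Qed.

Lemma dbl_diag_l v i : dbl_diag v (lshift n i) (lshift n i) = v 0 i.
Proof. by rewrite mxE eqxx row_mxEl. Qed.

Lemma dbl_diag_r v i : dbl_diag v (rshift n i) (rshift n i) = v 0 i.
Proof. by rewrite mxE eqxx row_mxEr. Qed.

Lemma diag2_linear a (u v : 'rV[R]_n) :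
  diag2 (a *: u + v) = a *: diag2 u + diag2 v :> cmx R n.
Proof.
apply: (congr1 fst (_ : re_part _ = re_part (a *: diag2 u + diag2 v))).
by rewrite -Phi_dbl_diag dbl_diag_linear [LHS]linearP /= !Phi_dbl_diag [RHS]linearP.
Qed.

Lemma aspaceP (A : cmx R n) : A \in aspace R n <->
  exists v : 'rV[R]_n, A = diag2 v /\ \sum_i v 0 i = 0.
Proof.
apply: mem_set_span => [|a _ _ [u [-> u0]] [v [-> v0]]].
  exists 0; split; last by rewrite big1 // => i _; rewrite mxE.
  by have := diag2_linear (-1) 0 0; rewrite scaler0 addr0 scaleN1r addNr.
exists (a *: u + v); split; first by rewrite diag2_linear.
under eq_bigr => i _ do rewrite !mxE.
by rewrite big_split /= -mulr_sumr u0 v0 mulr0 addr0.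
Qed.

Lemma omega_scalar j : scalar (@omega R n j).
Proof.
move=> a X Y; rewrite /omega !mxE.
by case: (X _ _) (Y _ _) => [x y] [z t] /=; rewrite mul0r subr0.
Qed.
HB.instance Definition _ j :=
  GRing.isLinear.Build R (cmx R n) R *%R (@omega R n j) (omega_scalar j).

Lemma rroot_scalar j k : scalar (@rroot R n j k).
Proof. by move=> a X Y; rewrite /rroot !linearP /= opprD addrACA -mulrBr. Qed.
HB.instance Definition _ j k :=
  GRing.isLinear.Build R (cmx R n) R *%R (@rroot R n j k) (rroot_scalar j k).

Lemma simple_root_scalar i : scalar (@simple_root R n i).
Proof. exact: rroot_scalar. Qed.
HB.instance Definition _ i :=
  GRing.isLinear.Build R (cmx R n) R *%R (@simple_root R n i) (simple_root_scalar i).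

Lemma omega_Hdual p (i : 'I_n.-1) :
  omega p (Hdual R i) = (p <= i)%N%:R - i.+1%:R / n%:R.
Proof. by rewrite /Hdual omega_diag2 mxE. Qed.

Lemma simple_root_sum (P : pred 'I_n.-1) (c : 'I_n.-1 -> R) i :
  simple_root i (\sum_(j | P j) c j *: Hdual R j) = if P i then c i else 0.
Proof.
rewrite linear_sum; under eq_bigr => j _ do rewrite linearZ /= simple_root_dual.
rewrite big_mkcond (bigD1 i) //= eqxx mulr1 big1 ?addr0 // => j ji.
by case: (P j); rewrite // eq_sym (negPf ji) mulr0.
Qed.

(** The difference of the two sides lies in [aspace] and is killed by all simple roots, so its
    diagonal is constant; having sum zero, it vanishes. *)
Lemma diag2_Hdual (v : 'rV[R]_n) : \sum_i v 0 i = 0 ->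
  diag2 v = \sum_(i < n.-1) simple_root i (diag2 v : cmx R n) *: Hdual R i.
Proof.
move=> v0; apply/eqP; rewrite -subr_eq0; apply/eqP.
set D := _ - _.
have : D \in aspace R n.
  rewrite memvB ?diag2_mem // memv_suml // => i _.
  by rewrite memvZ ?Hdual_mem.
move=> /aspaceP[w [Dw w0]].
have D0 i : simple_root i D = 0 by rewrite linearB /= simple_root_sum subrr.
rewrite {}Dw in D0 *.
have wE (p q : 'I_n) : p = q.+1 :> nat -> w 0 p = w 0 q.
  move=> pq; have qn : (q < n.-1)%N by have := ltn_ord p; lia.
  have /eqP := D0 (Ordinal qn); rewrite /simple_root /rroot !omega_diag2 subr_eq0 => /eqP wq.
  rewrite (_ : p = Ordinal (ord_succ_subproof (Ordinal qn))); last exact: val_inj.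
  by rewrite -wq; congr (w 0 _); apply: val_inj.
have wC (p q : 'I_n) : w 0 p = w 0 q.
  wlog pq : p q / (p <= q)%N => [H|].
    by case: (leqP p q) => [|/ltnW] /H.
  case: q pq => q; elim: q => [|q IHq] qn pq.
    by congr (w 0 _); apply: val_inj => /=; apply/eqP; rewrite -leqn0.
  move: pq; rewrite leq_eqVlt => /predU1P[e|pq].
    by congr (w 0 _); apply: val_inj.
  by rewrite (IHq (ltnW qn)) //; symmetry; apply: wE.
have -> : w = 0.
  apply/rowP=> p; rewrite mxE.
  move: w0; rewrite (eq_bigr (fun=> w 0 p)) => [|q _]; last exact: wC.
  rewrite sumr_const card_ord => /eqP; rewrite mulrn_eq0 => /orP[n0|/eqP//].
  by have := leq_ltn_trans (leq0n p) (ltn_ord p); rewrite lt0n n0.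
by have := diag2_linear (-1) 0 0; rewrite scaler0 addr0 scaleN1r addNr.
Qed.

End QuatSpan.

(** * The attached subalgebra as a block-triangular algebra *)

Section Attached.
Context (R : realType) (n : nat) (I : {set 'I_n.-1}) (c : 'I_n.-1 -> nat).
Hypothesis c_gt0 : {in I, forall i, (0 < c i)%N}.
Let Z : cmx R n := \sum_(i in I) (c i)%:R *: Hdual R i.

(* The blocks are the maximal intervals of indices not separated by a simple
   root outside [Lambda' Z]. *)
Definition block_label (k : 'I_n) : nat := \sum_(i in I) (i < k)%N.
Local Notation lab := block_label.

(** The simple root [i] is omega_i - omega_(i+1), so it cuts between i and i + 1; it separates p
    from q exactly when p <= i < q. *)
Lemma block_label_ltP (p q : 'I_n) :
  reflect (exists2 i, i \in I & (p <= i < q)%N) (lab p < lab q)%N.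
Proof.
apply: (iffP idP) => [pq|[i iI /andP[pi iq]]].
  case: (pickP [pred i | (i \in I) && (p <= i < q)%N]) => [i /andP[iI iq]|none].
    by exists i.
  suff : (lab q <= lab p)%N by rewrite leqNgt pq.
  apply: leq_sum => i iI; move: (none i); rewrite /= iI /= [(p <= i)%N]leqNgt.
  by case: (i < p)%N; case: (i < q)%N.
rewrite /lab (bigD1 i) //= [X in (_ < X)%N](bigD1 i) //= iq (ltnNge i p) pi /= add0n add1n ltnS.
by apply: leq_sum => j _; lia.
Qed.

Lemma block_label_lt (p q : 'I_n) : (lab p < lab q)%N -> (p < q)%N.
Proof. by case/block_label_ltP=> i _ /andP[]; apply: leq_ltn_trans. Qed.

Let rrootZ (p q : 'I_n) :
  rroot p q Z = \sum_(i in I) (c i)%:R * ((p <= i)%N%:R - (q <= i)%N%:R).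
Proof.
rewrite linear_sum; apply: eq_bigr => i _.
by rewrite linearZ /= /rroot !omega_Hdual opprB addrA subrK.
Qed.

(** For p before q, the root adds up the positive coefficients [c i] of the cuts between them; in
    the other order the sum is nonpositive. Its sign thus depends on [Z] only through the blocks. *)
Lemma rroot_gt0 (p q : 'I_n) : (0 < rroot p q Z) = (lab p < lab q)%N.
Proof.
rewrite rrootZ; apply/idP/block_label_ltP => [pq|[i iI /andP[pi iq]]].
  case: (pickP [pred i | (i \in I) && (p <= i < q)%N]) => [i /andP[iI iq]|none].
    by exists i.
  move: pq; rewrite ltNge => /negP[]; apply: sumr_le0 => i iI.
  move: (none i); rewrite /= iI /= [(q <= i)%N]leqNgt.
  by case: (p <= i)%N; case: (i < q)%N => //= _; rewrite ?subrr ?sub0r ?mulr0 ?mulrN1 ?oppr_le0.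
rewrite (bigD1 i) //= pi leqNgt iq subr0 mulr1 ltr_wpDr //; last first.
  by rewrite ltr0n c_gt0.
apply: sumr_ge0 => j _; rewrite mulr_ge0 // subr_ge0 ler_nat; lia.
Qed.

Let Lambda'Z : ~: Lambda' Z = I.
Proof.
apply/setP=> i; rewrite !inE simple_root_sum; case: ifP => [iI|]; last by rewrite eqxx.
by rewrite pnatr_eq0 -lt0n c_gt0.
Qed.

Let Z_aspace : Z \in aspace R n.
Proof. by apply: memv_suml => i _; rewrite memvZ ?Hdual_mem. Qed.

Lemma parabolic_dbl_diag (v : 'rV[R]_n) :
  (forall p q, lab p = lab q -> v 0 p = v 0 q) -> \sum_i v 0 i = 0 ->
  parabolic (dbl lab) (dbl_diag v).
Proof.
move=> vc v0; split=> [p q pq _|p q|].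
- by rewrite mxE (negPf pq) mulr0n.
- case: (split_ordP p) => i ->; case: (split_ordP q) => j ->;
  by rewrite ?dbl_lshift ?dbl_rshift ?dbl_diag_l ?dbl_diag_r; apply: vc.
rewrite big_split_ord /=; under eq_bigr => i _ do rewrite dbl_diag_l.
by under [X in _ + X]eq_bigr => i _ do rewrite dbl_diag_r; rewrite v0 addr0.
Qed.

Definition diag_part (x : 'M[R]_(n + n)) : 'rV[R]_n :=
  \row_i x (lshift n i) (lshift n i).

Lemma parabolic_upper x : parabolic (dbl lab) x ->
  upper (dbl lab) (x - dbl_diag (diag_part x)).
Proof.
move=> [x1 x2 x3] p q npq; rewrite mxE [X in _ + X]mxE.
have [<-|pq] := eqVneq p q; last first.
  by rewrite x1 // mxE (negPf pq) mulr0n oppr0 addr0.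
case: (split_ordP p) => i ->; rewrite ?dbl_diag_l ?dbl_diag_r mxE ?subrr //.
by rewrite (x2 _ (lshift n i)) ?subrr // dbl_lshift dbl_rshift.
Qed.

Lemma diag_part_sum x : parabolic (dbl lab) x -> \sum_i diag_part x 0 i = 0.
Proof.
move=> [x1 x2]; rewrite big_split_ord /=.
rewrite [X in _ + X](eq_bigr (fun i => x (lshift n i) (lshift n i))) => [|i _]; last first.
  by apply: x2; rewrite dbl_lshift dbl_rshift.
move=> x3; under eq_bigr => i _ do rewrite mxE.
by lra.
Qed.

Lemma diag_part_const x p q : parabolic (dbl lab) x -> lab p = lab q ->
  diag_part x 0 p = diag_part x 0 q.
Proof. by move=> [_ x2 _] pq; rewrite !mxE; apply: x2; rewrite !dbl_lshift. Qed.

Lemma quat_nspace' (j k : 'I_n) : (j < k)%N ->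
  [/\ Phi (quatA R j k) \in nspace' R n, Phi (quatB R j k) \in nspace' R n,
      Phi (quatC R j k) \in nspace' R n & Phi (quatD R j k) \in nspace' R n].
Proof.
move=> jk; rewrite Phi_quatA Phi_quatB Phi_quatC Phi_quatD.
have sub i : (i < 4)%N -> nth 0 [:: im_part (genA R j k); re_part (genB R j k);
    im_part (genC R j k); re_part (genD R j k)] i \in nspace' R n.
  by move=> i4; apply: subvP (memv_span (mem_nth 0 _)); rewrite ?(sumv_sup (j, k)).
by split; [exact: (sub 0%N)|exact: (sub 1%N)|exact: (sub 2%N)|exact: (sub 3%N)].
Qed.

(** Taking the index itself as label describes the full nilradical, whose blocks are single
    quaternion entries. *)
Lemma nspace'P u : u \in nspace' R n -> exists2 x, upper (dbl (@nat_of_ord n)) x & u = Phi x.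
Proof.
pose S := set_span [set u : gC R n | exists2 x, upper (dbl (@nat_of_ord n)) x & u = Phi x].
have SE v : v \in S <-> exists2 x, upper (dbl (@nat_of_ord n)) x & v = Phi x.
  apply: mem_set_span => [|a _ _ [x xu ->] [y yu ->]].
    by exists 0; [apply: upper0|rewrite linear0].
  exists (a *: x + y); last by rewrite linearP.
  by move=> p q pq; rewrite !mxE xu ?yu // mulr0 addr0.
move=> uN; apply/SE; apply: subvP uN; apply/subv_sumP => -[j k] /= jk.
apply/span_subvP => v; rewrite !inE => /or4P[]/eqP->; apply/SE.
- by exists (quatA R j k); rewrite ?Phi_quatA //; apply: quat_upper.
- by exists (quatB R j k); rewrite ?Phi_quatB //; apply: quat_upper.
- by exists (quatC R j k); rewrite ?Phi_quatC //; apply: quat_upper.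
- by exists (quatD R j k); rewrite ?Phi_quatD //; apply: quat_upper.
Qed.

Lemma quat_nroot' a b c' d j k : Phi (quat_mx a b c' d j k) \in nspace' R n ->
  Phi (quat_mx a b c' d j k) \in nroot' R j k.
Proof.
move=> qn; apply: (set_spanP _).1; split=> // A /aspaceP[v [-> _]].
rewrite -Phi_dbl_diag brC_Phi lie_dbl_diag_quat linearZ /=.
by rewrite /rroot !omega_diag2.
Qed.

Lemma dbl_diag_lie_entry (v : 'rV[R]_n) x p q :
  lie_mx (dbl_diag v) x p q =
  (row_mx v v 0 p - row_mx v v 0 q) * x p q.
Proof.
rewrite /lie_mx /dbl_diag mul_diag_mx mul_mx_diag !mxE; ring.
Qed.

(** Testing the root condition on [Z] alone suffices: an entry of X survives only where its own root
    takes on [Z] the positive value [rroot j k Z], hence above the blocks. *)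
Lemma nroot'_upper j k X : (lab j < lab k)%N -> X \in nspace' R n ->
  {in aspace R n, forall A, brC (re_part A) X = rroot j k A *: X} ->
  exists2 x, upper (dbl lab) x & X = Phi x.
Proof.
rewrite -rroot_gt0 => r_gt0 /nspace'P[x _ ->] /(_ Z Z_aspace) brx; exists x => //.
have /aspaceP[v [Zv _]] := Z_aspace.
move: brx r_gt0; set r := rroot j k Z.
rewrite Zv -Phi_dbl_diag brC_Phi -linearZ => /Phi_inj/matrixP rx r_gt0 p q npq.
have [[i [pi vi]] [m [qm vm]]] : (exists i, dbl lab p = lab i /\ row_mx v v 0 p = v 0 i) /\
    (exists m, dbl lab q = lab m /\ row_mx v v 0 q = v 0 m).
  by split; [case: (split_ordP p)|case: (split_ordP q)] => i ->; exists i;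
    rewrite ?dbl_lshift ?dbl_rshift ?row_mxEl ?row_mxEr.
have := rx p q; rewrite dbl_diag_lie_entry vi vm [RHS]mxE => /eqP.
rewrite -subr_eq0 -mulrBl mulf_eq0 => /orP[|/eqP//].
rewrite subr_eq0 => /eqP vr; move: npq; rewrite pi qm -rroot_gt0.
by rewrite Zv /rroot !omega_diag2 vr r_gt0.
Qed.

(** A parabolic matrix is a diagonal matrix constant on blocks, giving the part in [attached_a],
    plus a strictly block upper one, giving the root spaces. *)
Lemma mem_attached_s' u : u \in attached_s' Z <->
  exists2 x, parabolic (dbl lab) x & u = Phi x.
Proof.
pose S := set_span [set u : gC R n | exists2 x, parabolic (dbl lab) x & u = Phi x].
have SE v : v \in S <-> exists2 x, parabolic (dbl lab) x & v = Phi x.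
  apply: mem_set_span => [|a _ _ [x xu ->] [y yu ->]].
    by exists 0; [apply: parabolic0|rewrite linear0].
  by exists (a *: x + y); [apply: parabolic_lin|rewrite linearP].
split=> [uU|[x px ->]].
  apply/SE; apply: subvP uU; rewrite /attached_s' subv_add; apply/andP; split.
    rewrite /attached_a Lambda'Z limg_span; apply/span_subvP => v.
    case/mapP=> X /fintype.imageP[i iI ->] ->; apply/SE; rewrite lfunE /=.
    rewrite /Hdual -Phi_dbl_diag; eexists; last by [].
    have /aspaceP[w [/(congr1 (fun A => \row_p @omega R n p A)) Hw w0]] := Hdual_mem R i.
    have Ew : (\row_k ((k <= i)%N%:R - i.+1%:R / n%:R)) = w.
      by apply/rowP=> p; have /rowP/(_ p) := Hw; rewrite !mxE omega_Hdual omega_diag2.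
    (* Indices of one block lie on the same side of every cut in [I], so the diagonal of [Hdual i]
       is constant on blocks. *)
    have le_label p q : lab p = lab q -> (p <= i)%N -> (q <= i)%N.
      move=> pq pi; rewrite leqNgt; apply/negP=> iq.
      suff : (lab p < lab q)%N by rewrite pq ltnn.
      by apply/block_label_ltP; exists i; rewrite // pi.
    apply: parabolic_dbl_diag => [p q pq|]; last by rewrite Ew.
    rewrite !mxE; congr (_%:R - _).
    by congr nat_of_bool; apply/idP/idP; apply: le_label.
  apply/subv_sumP => -[j k] /= /andP[_ jk]; apply: (set_spanP _).2 => X [XN HX].
  rewrite rroot_gt0 in jk; have [x xu ->] := nroot'_upper jk XN HX.
  by apply/SE; exists x => //; apply: upper_parabolic.
rewrite -[x](subrK (dbl_diag (diag_part x))) addrC linearD /= Phi_dbl_diag.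
apply: memv_add.
  rewrite -(lfunE (@re_part R n)) memv_img //.
  rewrite diag2_Hdual ?diag_part_sum // memv_suml // => i _.
  have [iI|niI] := boolP (i \in I).
    rewrite memvZ // /attached_a Lambda'Z memv_span //.
    by apply/fintype.imageP; exists i.
  (* For i outside [I] the indices i and i + 1 share a block, so the coefficient of [Hdual i]
     vanishes. *)
  rewrite /simple_root /rroot !omega_diag2.
  set p := widen_ord _ _; set q := Ordinal _.
  rewrite (diag_part_const (p := p) (q := q) px) ?subrr ?scale0r ?mem0v //.
  have nqp : ~~ (lab q < lab p)%N.
    by apply/negP=> /block_label_lt; rewrite /= ltnNge leqnSn.
  apply/anti_leq; rewrite (leqNgt (lab q)) (leqNgt (lab p)) nqp /=; apply/negP.
  case/block_label_ltP=> m mI /=; rewrite ltnS -eqn_leq => /eqP/val_inj im.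
  by rewrite im mI in niI.
apply: upper_mem (parabolic_upper px) => j k jk.
have [qA qB qC qD] := quat_nspace' (block_label_lt jk).
have sub v : v \in nroot' R j k -> v \in attached_n' Z.
  apply/subvP; rewrite /attached_n' (sumv_sup (j, k)) //=.
  by rewrite block_label_lt ?rroot_gt0.
split; apply: sub.
- exact: quat_nroot' qA.
- exact: quat_nroot' qB.
- exact: quat_nroot' qC.
- exact: quat_nroot' qD.
Qed.

End Attached.

(** * The Killing form of sl(n, H) *)

Section Killing.
Context (R : realType) (n : nat).
Local Notation MC := 'M[R[i]]_(n + n).
Implicit Types (z X Y : MC).
Local Notation Re := (@complex.Re R).
Local Notation Im := (@complex.Im R).

(* The antilinear involution whose fixed points form gl(n, H). *)
Definition tau z : MC := - (Jmx n _ *m map_mx conjc z *m Jmx n _).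

Lemma tau_block (P Q S T : 'M[R[i]]_n) : tau (block_mx P Q S T) =
  block_mx (map_mx conjc T) (- map_mx conjc S) (- map_mx conjc Q) (map_mx conjc P).
Proof. by rewrite /tau map_block_mx Jmx_block opp_block_mx !opprK. Qed.

Lemma tauD z t : tau (z + t) = tau z + tau t.
Proof. by rewrite /tau map_mxD mulmxDr mulmxDl opprD. Qed.

Lemma tauZ a z : tau (a *: z) = conjc a *: tau z.
Proof. by rewrite /tau map_mxZ -scalemxAr -scalemxAl scalerN. Qed.

Lemma tauM z t : tau (z *m t) = tau z *m tau t.
Proof.
rewrite /tau map_mxM; move: (map_mx conjc z) (map_mx conjc t) => a b.
rewrite mulmxN mulNmx opprK !mulmxA.
by rewrite -[_ *m Jmx n _ *m Jmx n _]mulmxA mul_Jmx mulmxN mulmx1 !mulNmx.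
Qed.

Lemma tauB z t : tau (z - t) = tau z - tau t.
Proof. by rewrite tauD -scaleN1r tauZ rmorphN1 scaleN1r. Qed.

Definition proj_slnH (z : cmx R n) : cmx R n := (2^-1 : R) *: (z + (tau z : cmx R n)).

Lemma conj_mxK m (X : 'M[R[i]]_m) : map_mx conjc (map_mx conjc X) = X.
Proof. by apply/matrixP=> p q; rewrite !mxE conjcK. Qed.

Lemma conj_mxZ m (a : R) (X : 'M[R[i]]_m) :
  map_mx conjc (a%:C%C *: X) = a%:C%C *: map_mx conjc X.
Proof.
apply/matrixP=> p q; rewrite !mxE.
by case: (X p q) => x y; congr Complex; ring.
Qed.

Lemma slnH_tau z : z \in slnH R n -> tau z = z.
Proof.
move=> zs; apply/(mem_set_span (P := [set z : cmx R n | tau z = z])) => [|a x y|].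
- by rewrite /= -(scale0r (0 : MC)) tauZ rmorph0 !scale0r.
- rewrite /= => xt yt.
  by rewrite cmx_scaleE tauD tauZ xt yt conjc_real.
apply: subvP zs; apply: (set_spanP _).2 => _ [X [Y [-> _]]].
apply: (set_spanP _).1; rewrite /= tau_block.
by rewrite map_mxN opprK !conj_mxK.
Qed.

Lemma proj_slnH_mem z : \tr z = 0 -> proj_slnH z \in slnH R n.
Proof.
move=> tz; apply: (set_spanP _).1.
move: tz; rewrite -[z]submxK; move: (ulsubmx z) (ursubmx z) (dlsubmx z) (drsubmx z).
move=> P Q S T tz; rewrite /proj_slnH tau_block cmx_scaleE add_block_mx scale_block_mx.
exists ((2^-1)%:C%C *: (P + map_mx conjc T)), ((2^-1)%:C%C *: (S - map_mx conjc Q)).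
rewrite !conj_mxZ !map_mxD map_mxN !conj_mxK; split.
  by rewrite -scalerN opprD opprK [- _ + _]addrC [T + _]addrC.
move: tz; rewrite mxtrace_block => /eqP; rewrite addr_eq0 => /eqP PT.
rewrite -scalerDr linearZ !linearD /= !trace_map_mx PT rmorphN.
by rewrite -addrA [_ + (- _ + _)]addrA subrr add0r addNr mulr0.
Qed.

Let ReD (u v : R[i]) : Re (u + v) = Re u + Re v.
Proof. by case: u v => [a b] [c d]. Qed.
Let ImD (u v : R[i]) : Im (u + v) = Im u + Im v.
Proof. by case: u v => [a b] [c d]. Qed.
Let ReZ (a : R) (u : R[i]) : Re (a%:C%C * u) = a * Re u.
Proof. by case: u => [x y] /=; rewrite mul0r subr0. Qed.
Let ImZ (a : R) (u : R[i]) : Im (a%:C%C * u) = a * Im u.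
Proof. by case: u => [x y] /=; rewrite mul0r addr0. Qed.

Lemma Re_sum (I : finType) (F : I -> R[i]) : Re (\sum_i F i) = \sum_i Re (F i).
Proof. exact: (big_morph _ ReD). Qed.

(** The left side is the complex trace of ad X ad Y on gl(2n, C), equal to 2N tr(XY) - 2 tr X tr Y
    in general, with N = 2n. *)
Lemma trace_comm_comm X Y : \tr X = 0 ->
  \sum_p \sum_q (br X (br Y (delta_mx p q : MC)) : MC) p q =
  (2 * (n + n))%:R * \tr (X *m Y).
Proof.
move=> tX.
have E p q : (br X (br Y (delta_mx p q : MC)) : MC) p q =
    (X *m Y) p p + (Y *m X) q q - X p p * Y q q - Y p p * X q q.
  have El (A : MC) : (A *m delta_mx p q) p q = A p p.
    rewrite mxE (bigD1 p) //= mxE !eqxx mulr1 big1 ?addr0 // => r rp.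
    by rewrite mxE (negPf rp) mulr0.
  have Er (A : MC) : (delta_mx p q *m A) p q = A q q.
    rewrite mxE (bigD1 q) //= mxE !eqxx mul1r big1 ?addr0 // => r rq.
    by rewrite mxE (negPf rq) andbF mul0r.
  have Elr (A B : MC) : (A *m delta_mx p q *m B) p q = A p p * B q q.
    rewrite mxE (bigD1 q) //= El big1 ?addr0 // => r rq.
    rewrite mxE big1 ?mul0r // => t _.
    by rewrite mxE (negPf rq) andbF mulr0.
  rewrite /br mulmxBr mulmxBl !mulmxA.
  have entB (A B : MC) : (A - B) p q = A p q - B p q by rewrite mxE [X in _ + X]mxE.
  rewrite !entB El !Elr -[delta_mx p q *m Y *m X]mulmxA Er.
  by ring.
under eq_bigr => p _ do under eq_bigr => q _ do rewrite E.
under eq_bigr => p _ do rewrite !sumrB big_split /= sumr_const card_ord -!mulr_sumr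
  -[\sum_i X i i]/(\tr X) tX mulr0 subr0.
rewrite sumrB big_split /= -mulr_suml -[\sum_i X i i]/(\tr X) tX mul0r subr0.
rewrite sumr_const card_ord sumrMnl -[\sum_i (X *m Y) i i]/(\tr (X *m Y)).
rewrite -[\sum_i (Y *m X) i i]/(\tr (Y *m X)) [\tr (Y *m X)]mxtrace_mulC.
by rewrite -mulr2n -mulrnA mulnC mulr_natl.
Qed.

(* Because gl(n, H) is a real form of gl(2n, C), the real trace on it of a
   complex-linear map preserving it is the complex trace on gl(2n, C). *)
Lemma killing_slnH X Y : tau X = X -> tau Y = Y -> \tr X = 0 ->
  killing_form (@br R n) (slnH R n) X Y = (2 * (n + n))%:R * Re (\tr (X *m Y)).
Proof.
move=> tX tY trX.
pose f (z : cmx R n) : cmx R n := br X (br Y z).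
have fZ a (z : MC) : f (a *: z) = (a *: (f z : MC)) :> MC.
  rewrite /f /br; rewrite -!scalemxAr -!scalemxAl -!scalerBr.
  by rewrite -!scalemxAr -!scalemxAl -!scalerBr.
have brD (A z t : MC) : br A (z + t) = (br A z + br A t : MC) :> MC.
  by rewrite /br mulmxDr mulmxDl opprD addrACA.
have fD (z t : MC) : f (z + t) = (f z + f t : MC) :> MC.
  by rewrite /f !brD.
have ftau (z : cmx R n) : tau z = z -> tau (f z) = f z.
  by move=> zt; rewrite /f /br !(tauB, tauM) tX tY zt.
have trf (z : cmx R n) : \tr (f z : MC) = 0.
  by rewrite /f /br raddfB /= mxtrace_mulC subrr.
have proj_f (z : cmx R n) : z \in slnH R n -> proj_slnH (f z) = f z.
  move=> zs; rewrite /proj_slnH ftau ?slnH_tau // -mulr2n -scaler_nat scalerA.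
  by rewrite mulVf ?scale1r // pnatr_eq0.
(* [f] agrees with [G] on sl(n, H), but [G] sends even the matrix units into it, since commutators
   are traceless. This gives the rank-one expansion over E_pq and i E_pq. *)
pose G z := proj_slnH (f z).
have linG : linear_on fullv (G : cmx R n -> cmx R n).
  move=> a x y _ _.
  suff : (2^-1)%:C%C *: ((f (a%:C%C *: (x : MC) + y) : MC) + tau (f (a%:C%C *: (x : MC) + y))) =
      a%:C%C *: ((2^-1)%:C%C *: ((f x : MC) + tau (f x))) +
      (2^-1)%:C%C *: ((f y : MC) + tau (f y)) by [].
  rewrite fD fZ; move: (f x : MC) (f y : MC) => u v.
  rewrite tauD tauZ conjc_real.
  by rewrite addrACA -scalerDr [LHS]scalerDr !scalerA [_ * a%:C%C]mulrC.
pose E (k : ('I_(n + n) * 'I_(n + n)) * bool) : cmx R n :=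
  (if k.2 then 'i%C else 1) *: (delta_mx k.1.1 k.1.2 : MC).
pose phi (k : ('I_(n + n) * 'I_(n + n)) * bool) (z : cmx R n) : R^o :=
  if k.2 then Im (z k.1.1 k.1.2) else Re (z k.1.1 k.1.2).
have split_sum (W : nmodType) (F : ('I_(n + n) * 'I_(n + n)) * bool -> W) :
    \sum_k F k = \sum_p \sum_q (F ((p, q), true) + F ((p, q), false)).
  rewrite pair_bigA (eq_bigr (fun pq => \sum_b F (pq, b))) => [|[p q] _].
    by rewrite pair_bigA; apply: eq_bigr => -[].
  by rewrite big_bool.
have zE z : z = \sum_k phi k z *: E k.
  rewrite split_sum [LHS]matrix_sum_delta; apply: eq_bigr => p _; apply: eq_bigr => q _.
  suff : z p q *: (delta_mx p q : MC) = (Im (z p q))%:C%C *: ('i%C *: delta_mx p q) +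
      (Re (z p q))%:C%C *: (1 *: delta_mx p q) by [].
  by rewrite scale1r scalerA -scalerDl addrC [_ * 'i%C]mulrC -complexE.
have entD (A B : MC) p q : (A + B) p q = A p q + B p q by rewrite mxE.
have entZ a (A : MC) p q : (a *: A) p q = a * A p q by rewrite mxE.
rewrite /killing_form (@trace_on_frame _ _ _ _ _ phi (G \o E)).
- rewrite split_sum -ReZ -[(_%:R)%:C%C]/((real_complex R) _) rmorph_nat -trace_comm_comm //.
  rewrite Re_sum; apply: eq_bigr => p _; rewrite Re_sum; apply: eq_bigr => q _.
  pose A : MC := f (delta_mx p q : MC).
  (* As [f] is complex-linear and [tau] antilinear, the two contributions are Im(i(A - tau A))/2 and
     Re(A + tau A)/2; the [tau] parts cancel and Re A remains. *)
  suff : Im (((2^-1)%:C%C *: ((f ('i%C *: (delta_mx p q : MC)) : MC) +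
      tau (f ('i%C *: (delta_mx p q : MC))))) p q) +
      Re (((2^-1)%:C%C *: ((f (1 *: (delta_mx p q : MC)) : MC) + tau (f (1 *: (delta_mx p q : MC))))) p q) =
      Re (A p q) by [].
  rewrite (fZ 'i%C) (fZ 1) -/A; move: A => A.
  rewrite scale1r tauZ !entZ !entD !entZ ReZ ImZ ReD ImD.
  case: (A p q) => a b; case: (tau A p q) => a' b' /=. field.
- by [].
- move=> k a x y _ _.
  suff : (if k.2 then Im ((a%:C%C *: (x : MC) + y) k.1.1 k.1.2)
      else Re ((a%:C%C *: (x : MC) + y) k.1.1 k.1.2)) =
    a * (if k.2 then Im (x k.1.1 k.1.2) else Re (x k.1.1 k.1.2)) +
    (if k.2 then Im (y k.1.1 k.1.2) else Re (y k.1.1 k.1.2)) by [].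
  by case: k.2; rewrite entD entZ ?ReD ?ImD ?ReZ ?ImZ.
- by move=> k; apply: proj_slnH_mem.
move=> z zs; rewrite -[LHS](proj_f z zs) [in LHS](zE z).
by rewrite -[LHS]/(G _) (linear_on_sum _ linG) // => k; rewrite memvf.
Qed.

End Killing.

(** * The metric *)

Section Theta.
Context (R : realType) (n : nat).
Local Notation M := 'M[R]_(n + n).
Local Notation MC := 'M[R[i]]_(n + n).
Implicit Types (x y : M) (z : MC).
Local Notation cx := (map_mx (real_complex R)).
Local Notation Re := (@complex.Re R).
Local Notation J := (Jmx n R).

(** The linear map through which the metric is read. Products of two odd parts acquire the sign of
    the square of 'i, so, unlike [Phi], it is not multiplicative. *)
Definition Theta x : MC := untwist (Phi x).

Lemma ThetaE x : Theta x = conjT (cx (evenp x) + 'i%C *: cx (oddp x)).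
Proof. by rewrite /Theta /untwist /Phi /= linearD linearZ. Qed.

Lemma conj_cx x : map_mx conjc (cx x) = cx x.
Proof. by apply/matrixP=> p q; rewrite !mxE conjc_real. Qed.

Let JJ : J *m J = - 1%:M := mul_Jmx n R.

Lemma Jmx_conjK x : J *m (J *m x *m J) *m J = x.
Proof.
rewrite !mulmxA JJ -[_ *m J *m J]mulmxA JJ mulmxN mulmx1 !mulNmx mul1mx.
exact: opprK.
Qed.

Lemma Jmx_evenp x : J *m evenp x *m J = - evenp x.
Proof.
rewrite /evenp -scalemxAr -scalemxAl -scalerN opprB mulmxBr mulmxBl.
by rewrite Jmx_conjK.
Qed.

Lemma Jmx_oddp x : J *m oddp x *m J = oddp x.
Proof.
rewrite /oddp -scalemxAr -scalemxAl mulmxDr mulmxDl.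
by rewrite Jmx_conjK addrC.
Qed.

Lemma cx_Jmx : cx J = Jmx n _.
Proof. by rewrite /Jmx map_block_mx !map_mx0 map_mxN map_mx1. Qed.

Lemma conj_mxZc m (a : R[i]) (X : 'M[R[i]]_m) :
  map_mx conjc (a *: X) = conjc a *: map_mx conjc X.
Proof. by apply/matrixP=> p q; rewrite !mxE rmorphM. Qed.

Lemma conjci : conjc ('i%C : R[i]) = - ('i%C : R[i]).
Proof. by apply/eqP; rewrite eq_complex /= oppr0 !eqxx. Qed.

Lemma conjcNi : conjc (- ('i%C : R[i])) = ('i%C : R[i]).
Proof. by apply/eqP; rewrite eq_complex /= oppr0 opprK !eqxx. Qed.

Lemma tau_conjT z : tau (conjT z) = conjT (tau z).
Proof.
rewrite -[z]submxK; move: (ulsubmx z) (ursubmx z) (dlsubmx z) (drsubmx z) => P Q S T.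
rewrite conjT_block !tau_block conjT_block !conj_mxZc conjcNi conjci.
by rewrite !scaleNr !scalerN !opprK.
Qed.

(** Odd parts anticommute with [Jmx], and the resulting sign is compensated by conjugating the
    factor 'i. *)
Lemma tau_Theta x : tau (Theta x) = Theta x.
Proof.
rewrite ThetaE tau_conjT tauD tauZ; congr (conjT (_ + _)).
  by rewrite /tau conj_cx -cx_Jmx -!map_mxM Jmx_evenp map_mxN opprK.
rewrite /tau conj_cx -cx_Jmx -!map_mxM Jmx_oddp scalerN -scaleNr.
by rewrite conjci opprK.
Qed.

Lemma trace_Jmx x : \tr (J *m x *m J) = - \tr x.
Proof. by rewrite mxtrace_mulC mulmxA JJ mulNmx mul1mx linearN. Qed.

Lemma trace_evenp x : \tr (evenp x) = \tr x.
Proof. by rewrite /evenp linearZ linearB /= trace_Jmx; field. Qed.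

Lemma trace_oddp x : \tr (oddp x) = 0.
Proof. by rewrite /oddp linearZ linearD /= trace_Jmx; field. Qed.

Lemma trace_conjT z : \tr (conjT z) = \tr z.
Proof. by rewrite /conjT mxtrace_mulC mulmxA TmxK mul1mx. Qed.

Lemma trace_Theta x : \tr (Theta x) = (\tr x)%:C%C.
Proof.
rewrite ThetaE trace_conjT linearD linearZ /= !trace_map_mx trace_evenp trace_oddp.
by rewrite rmorph0 mulr0 addr0.
Qed.

Lemma tr_Jmx : J^T = - J.
Proof.
by rewrite /Jmx tr_block_mx !trmx0 linearN /= !trmx1 opp_block_mx !oppr0 opprK.
Qed.

Lemma tr_JmxK x : (J *m x *m J)^T = J *m x^T *m J.
Proof. by rewrite !trmx_mul tr_Jmx mulNmx !mulmxN opprK mulmxA. Qed.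

Lemma evenp_tr x : evenp x^T = (evenp x)^T.
Proof. by rewrite /evenp -tr_JmxK -linearB -linearZ. Qed.

Lemma oddp_tr x : oddp x^T = (oddp x)^T.
Proof. by rewrite /oddp -tr_JmxK -linearD -linearZ. Qed.

Lemma tr_conj_conjT z : (map_mx conjc (conjT z))^T = conjT (map_mx conjc z)^T.
Proof.
rewrite -[z]submxK; move: (ulsubmx z) (ursubmx z) (dlsubmx z) (drsubmx z) => P Q S T.
rewrite conjT_block !map_block_mx !tr_block_mx conjT_block !conj_mxZc conjcNi conjci.
by rewrite !linearZ.
Qed.

Lemma evenp_Jtr y : evenp (J *m y^T *m J) = - (evenp y)^T.
Proof.
rewrite -tr_JmxK evenp_tr -linearN; congr (_^T).
rewrite /evenp -scalerN opprB; congr (_ *: (_ - _)).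
exact: Jmx_conjK.
Qed.

Lemma oddp_Jtr y : oddp (J *m y^T *m J) = (oddp y)^T.
Proof.
rewrite -tr_JmxK oddp_tr; congr (_^T).
rewrite /oddp addrC; congr (_ *: (_ + _)).
exact: Jmx_conjK.
Qed.

(** Negative conjugate transposition sends even and odd parts E, O to - E^T and + O^T, the second
    sign coming from the conjugate of 'i; these are the parts of J y^T J. *)
Lemma cartan_Theta y : cartan_inv (Theta y) = Theta (J *m y^T *m J).
Proof.
rewrite /cartan_inv !ThetaE tr_conj_conjT evenp_Jtr oddp_Jtr -linearN; congr conjT.
rewrite map_mxD conj_mxZc conjci !conj_cx linearD linearZ /= !map_trmx map_mxN.
by rewrite opprD scaleNr opprK.
Qed.

(** In the Killing trace the 'i of [Theta] and the sign of the Cartan involution combine to the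
    trace of the even part of x y^T, which is the whole trace, plus a purely imaginary term. *)
Lemma B_sigma_Theta x y : \tr x = 0 ->
  B_sigma (Theta x) (Theta y) = (2 * (n + n))%:R * dot x y.
Proof.
move=> x0; rewrite /B_sigma cartan_Theta killing_slnH ?tau_Theta //; last first.
  by rewrite trace_Theta x0.
rewrite -mulrN; congr (_ * _).
rewrite dotE -trace_evenp evenpM evenp_tr oddp_tr !ThetaE evenp_Jtr oddp_Jtr.
rewrite -conjTM trace_conjT.
move: (evenp x) (evenp y)^T (oddp x) (oddp y)^T => a c b d.
have -> : (cx a + 'i%C *: cx b) *m (cx (- c) + 'i%C *: cx d) =
    cx (- (a *m c + b *m d)) + 'i%C *: cx (a *m d - b *m c).
  have ii : 'i%C * 'i%C = -1 :> R[i] by rewrite -expr2 sqr_i.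
  rewrite mulmxDl !mulmxDr -!scalemxAl -!scalemxAr scalerA ii scaleN1r.
  rewrite opprD !map_mxD !map_mxN !map_mxM !mulmxN scalerDr.
  move: (cx a *m cx c) (cx a *m cx d) (cx b *m cx d) (cx b *m cx c) => p q r s.
  by apply/matrixP=> j k; rewrite !mxE; ring.
rewrite linearD linearZ /= !trace_map_mx linearN /=.
move: (\tr (_ + _)) (\tr _) => u v.
by rewrite /=; ring.
Qed.

End Theta.

(** * The inner product of the attached subalgebra in matrix form *)

Section AttachedMetric.
Context (R : realType) (n : nat) (I : {set 'I_n.-1}).
Local Notation lab := (block_label I).

Let ThetaS : {linear 'M[R]_(n + n) -> cmx R n} := @untwist R n \o @Phi R n.

Lemma Theta_dbl_diag (v : 'rV[R]_n) : Theta (dbl_diag v) = diag2 v.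
Proof. by rewrite /Theta Phi_dbl_diag /untwist /= addr0. Qed.

Lemma quat_nspace (j k : 'I_n) : (j < k)%N ->
  [/\ ThetaS (quatA R j k) \in nspace R n, ThetaS (quatB R j k) \in nspace R n,
      ThetaS (quatC R j k) \in nspace R n & ThetaS (quatD R j k) \in nspace R n].
Proof.
move=> jk; rewrite /= Phi_quatA Phi_quatB Phi_quatC Phi_quatD /untwist /= !addr0 !add0r.
have sub i : (i < 4)%N ->
    nth 0 [:: genA R j k; genB R j k; genC R j k; genD R j k] i \in nspace R n.
  by move=> i4; apply: subvP (memv_span (mem_nth 0 _)); rewrite ?(sumv_sup (j, k)).
by split; [exact: (sub 0%N)|exact: (sub 1%N)|exact: (sub 2%N)|exact: (sub 3%N)].
Qed.

Lemma upper_nspace x : upper (dbl lab) x -> Theta x \in nspace R n.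
Proof.
move=> ux; apply: (upper_mem (l := lab) (f := ThetaS)) ux => j k jk.
exact: quat_nspace (block_label_lt jk).
Qed.

(** Root vectors with j < k have no diagonal entries. The trivial intersection makes the projections
    in [ip_s] meaningful. *)
Lemma aspace_nspace : (aspace R n :&: nspace R n = 0)%VS.
Proof.
apply/eqP; rewrite -subv0; apply/subvP=> X; rewrite memv_cap => /andP[Xa Xn].
have X0 i : omega i X = 0.
  have kerP Y : Y \in set_span [set Y : cmx R n | omega i Y = 0] <-> omega i Y = 0.
    apply: mem_set_span => [|a A B /= A0 B0]; first exact: (linear0 (@omega R n i)).
    by rewrite omega_scalar A0 B0 mulr0 addr0.
  apply/kerP.
  apply: subvP Xn; apply/subv_sumP => -[j k] /= jk; apply/span_subvP => v.
  have d0 : (i == j) && (i == k) = false.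
    by apply/negP=> /andP[/eqP ij /eqP ik]; rewrite -ij -ik ltnn in jk.
  rewrite !inE => /or4P[]/eqP->; apply/kerP; rewrite /omega !mxE;
    by rewrite ?eq_lshift ?eq_lrshift ?d0 ?andbF ?subrr ?addr0 ?mulr0.
move/aspaceP: Xa X0 => [v [-> _]] v0; rewrite memv0.
have -> : v = 0 by apply/rowP=> i; rewrite mxE -(v0 i) omega_diag2.
by have := diag2_linear (-1) (0 : 'rV[R]_n) 0; rewrite scaler0 addr0 scaleN1r addNr => ->.
Qed.

Lemma daddv_piDl (V : vectType R) (U W : {vspace V}) u w :
  (U :&: W = 0)%VS -> u \in U -> w \in W -> daddv_pi U W (u + w) = u.
Proof.
move=> UW uU wW; rewrite linearD /= daddv_pi_id //.
have := daddv_pi_add UW (memv_add (mem0v U) wW).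
rewrite add0r [daddv_pi W U w]daddv_pi_id ?[(W :&: U)%VS]capvC // => /eqP.
by rewrite -subr_eq0 addrK => /eqP->; rewrite addr0.
Qed.

Lemma par_form_split (x y : 'M[R]_(n + n)) :
    parabolic (dbl lab) x -> parabolic (dbl lab) y ->
  let D z := dbl_diag (diag_part z) in
  par_form x y = 2 * dot (D x) (D y) + dot (x - D x) (y - D y).
Proof.
move=> px py D; rewrite /par_form /dot mulr_sumr -!big_split; apply: eq_bigr => p _ /=.
have ux := parabolic_upper px; have uy := parabolic_upper py.
have Dp z : parabolic (dbl lab) z -> D z p p = z p p.
  move=> pz; apply/esym/eqP; rewrite -subr_eq0; apply/eqP.
  have uz := parabolic_upper pz.
  by have := uz p p; rewrite ltnn mxE [X in _ + X]mxE => ->.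
have Dq z q : q != p -> D z p q = 0.
  by move=> qp; rewrite mxE eq_sym (negPf qp).
rewrite (bigD1 p) //= [in RHS](bigD1 p) //= (bigD1 p (F := fun q => (x - D x) p q * _)) //=.
rewrite !Dp // ux ?ltnn // mul0r add0r [X in 2 * (_ + X)]big1 => [|q qp]; last first.
  by rewrite !Dq // mul0r.
rewrite addr0 [LHS]addrAC; congr (_ + _); first by ring.
apply: eq_bigr => q qp; rewrite mxE [X in _ + X]mxE Dq // subr0.
by rewrite mxE [X in _ + X]mxE Dq // subr0.
Qed.

(** The projections onto a and n become the diagonal and strictly upper parts of the matrix, so the
    factor 2 of [ip_s] falls exactly on the diagonal. *)
Lemma ip'_Phi (x y : 'M[R]_(n + n)) :
    parabolic (dbl lab) x -> parabolic (dbl lab) y ->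
  ip' (Phi x) (Phi y) = (2 * (n + n))%:R * par_form x y.
Proof.
move=> px py.
pose D (z : 'M[R]_(n + n)) := dbl_diag (diag_part z).
have ThE z : Theta z = Theta (D z) + Theta (z - D z) :> cmx R n.
  by rewrite -[z in LHS](subrK (D z)) addrC; exact: (linearD ThetaS).
have Da z : parabolic (dbl lab) z -> Theta (D z) \in aspace R n.
  by move=> pz; rewrite Theta_dbl_diag; apply/diag2_mem/(diag_part_sum pz).
have Un z : parabolic (dbl lab) z -> Theta (z - D z) \in nspace R n.
  by move=> pz; apply/upper_nspace/parabolic_upper.
have pa z : parabolic (dbl lab) z ->
    daddv_pi (aspace R n) (nspace R n) (Theta z) = Theta (D z).
  by move=> pz; rewrite (ThE z); apply: daddv_piDl (Da z pz) (Un z pz); apply: aspace_nspace.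
have pn z : parabolic (dbl lab) z ->
    daddv_pi (nspace R n) (aspace R n) (Theta z) = Theta (z - D z).
  move=> pz; rewrite (ThE z) [_ + _]addrC; apply: daddv_piDl (Un z pz) (Da z pz).
  by rewrite capvC; apply: aspace_nspace.
have trD z : parabolic (dbl lab) z -> \tr (D z) = 0.
  move=> pz; have [|_ _ //] := @parabolic_dbl_diag _ _ I (diag_part z) _ (diag_part_sum pz).
  by move=> p q; apply: diag_part_const pz.
have trU z : parabolic (dbl lab) z -> \tr (z - D z) = 0.
  by move=> pz; rewrite linearB /= trD // subr0; case: pz.
transitivity (2 * B_sigma (Theta (D x)) (Theta (D y)) +
    B_sigma (Theta (x - D x)) (Theta (y - D y))).
  exact: (f_equal2 (fun a b => 2 * a + b) (f_equal2 (@B_sigma R n) (pa x px) (pa y py))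
    (f_equal2 (@B_sigma R n) (pn x px) (pn y py))).
have eD := B_sigma_Theta (D y) (trD x px).
have eU := B_sigma_Theta (y - D y) (trU x px).
apply: etrans (f_equal2 (fun a b => 2 * a + b) eD eU) _.
by rewrite (par_form_split px py) mulrDr [in RHS]mulrCA.
Qed.

End AttachedMetric.

Theorem proposition3p3 (R : realType) (n : nat) (hn : (2 <= n)%N)
    (Z : cmx R n) (hZ : characteristic_element Z) :
  einstein_solvmanifold (@brC R n) (@ip' R n) (attached_s' Z).
Proof.
have [I [c [_ c_gt0 ->]]] := hZ.
(* The scale 4n is the Killing constant of sl(n, H). With N = 2n the Einstein constant -N / (2
   kappa) is -1/4, whatever n and Z are. *)
apply: (@parabolic_einstein_solvmanifold _ _ (dbl (block_label I)) _ _ _ _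
  (@Phi R n) (2 * (n + n))%:R).
- by rewrite ltr0n muln_gt0 addn_gt0 (ltnW hn).
- exact: mem_attached_s'.
- exact: brC_Phi.
exact: ip'_Phi.
Qed.
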